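(* For $K\in\mathbb{Z}_+\cup\{\infty\}$ let $\lambda_K(n)=1$ if $n\le K$ and $\lambda_K(n)=0$ otherwise (so $\lambda_\infty\equiv1$). For $K\in\mathbb{Z}_+$ let $$R_K=\{(\mu_1,\mu_2)\in(0,\infty)^2:\ 1-(\mu_1/\mu_2)^{K+1}<\min(\mu_1,\mu_2)\},$$ and let $R_\infty=\{(\mu_1,\mu_2)\in(0,\infty)^2:\ \min(\mu_1,\mu_2)>1\}$. Then for each $K\in\mathbb{Z}_+\cup\{\infty\}$, the set of $(\mu_1,\mu_2)\in(0,\infty)^2$ for which the system $S(\lambda_K,\mu_1,\mu_2)$ is stable equals $R_K$. Moreover $R_K\supset R_{K+1}$ for all $K\in\mathbb{Z}_+$, and the stabilizable region $\bigcup_{K\in\mathbb{Z}_+\cup\{\infty\}}R_K$ equals $R_0$.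
   Context: $\mathbb{Z}_+=\{0,1,2,\dots\}$ and $e_1,e_2$ are the unit vectors of $\mathbb{Z}_+^2$. The system $S(\lambda,\mu_1,\mu_2)$ (for a nonnegative function $\lambda$ on $\mathbb{Z}_+$ and $\mu_1,\mu_2>0$) is the set of transition rates $q(x,y)$, $x\ne y$, $x,y\in\mathbb{Z}_+^2$, given by $q(x,x+e_1)=\lambda(x_2)$; $q(x,x-e_1+e_2)=\mu_1$ if $x_1\ge1$; $q(x,x-e_2)=\mu_2$ if $x_2\ge 1$; and $q(x,y)=0$ otherwise. Set $q(x)=\sum_{y\ne x}q(x,y)<\infty$ and $q(x,x)=-q(x)$. These rates define, by the minimal construction, a unique continuous-time Markov process $X=(X_1,X_2)$ on $\mathbb{Z}_+^2\cup\{\kappa\}$, where $\kappa$ is an extra state entered at the explosion time. The system is called stable if this Markov process is ergodic, that is, irreducible and positive recurrent (on $\mathbb{Z}_+^2$). *)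

(* Defs.v *)
From HB Require Import structures.
From mathcomp Require Import all_boot all_order all_algebra.
From mathcomp Require Import all_classical all_reals all_analysis.
From mathcomp Require Import measurable_realfun.

Set Implicit Arguments.
Unset Strict Implicit.
Unset Printing Implicit Defensive.
Import Order.TTheory GRing.Theory Num.Theory.
Import numFieldNormedType.Exports.

Local Open Scope classical_set_scope.
Local Open Scope ring_scope.

(* Transition rates are functions [q x y] whose diagonal is never read: the    *)
(* entry q(x,x) = - q(x) is determined by the others. [fine] is harmless when  *)
(* the rows of [q] have finite sum.                                            *)
Definition exit_rate (R : realType) (I : countType) (q : I -> I -> R)
    (x : I) : R :=
  fine (\esum_(y in [set y | y != x]) (q x y)%:E).

(* An absorbing state jumps to itself, after an infinite holding time.         *)
Definition jump_prob (R : realType) (I : countType) (q : I -> I -> R)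
    (x y : I) : R :=
  if exit_rate q x == 0 then (x == y)%:R
  else if x == y then 0 else q x y / exit_rate q x.

(* A Markov family (P_x) given by jump chain and holding times: under P_x, the *)
(* chain (Y_n) starts at x and has transition matrix [jump_prob q]; given this *)
(* chain, the S_n are independent, exponential with parameter exit_rate q Y_n  *)
(* (S_n = +oo a.s. when this parameter is 0). [mp_law] gives the joint         *)
(* finite-dimensional distributions of the two sequences.                      *)
Record minimal_process (R : realType) (I : countType) (q : I -> I -> R) :=
  MinimalProcess {
    mp_disp : measure_display ;
    mp_space : measurableType mp_disp ;
    mp_prob : I -> probability mp_space R ;
    mp_chain : nat -> mp_space -> I ;
    mp_hold : nat -> mp_space -> \bar R ;
    mp_chain_meas : forall (n : nat) (y : I),
      measurable [set w | mp_chain n w = y] ;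
    mp_hold_meas : forall n : nat,
      measurable_fun [set: mp_space] (mp_hold n) ;
    mp_hold_ge0 : forall (n : nat) (w : mp_space), (0 <= mp_hold n w)%E ;
    mp_law : forall (x : I) (n : nat) (y : nat -> I) (t : nat -> R),
      (forall i, 0 <= t i) ->
      mp_prob x [set w | forall i, (i <= n)%N ->
                   mp_chain i w = y i /\ ((t i)%:E < mp_hold i w)%E]
      = ((x == y 0%N)%:R
         * (\prod_(i < n) jump_prob q (y i) (y i.+1))
         * (\prod_(i < n.+1) expR (- (exit_rate q (y i) * t i))))%:E }.

Definition jump_time (R : realType) (I : countType) (q : I -> I -> R)
    (M : minimal_process q) (n : nat) (w : mp_space M) : \bar R :=
  (\sum_(0 <= i < n) mp_hold i w)%E.

(* [None] is the state kappa, entered at the explosion time, i.e. the limit of *)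
(* the jump times.                                                             *)
Definition mp_state (R : realType) (I : countType) (q : I -> I -> R)
    (M : minimal_process q) (t : R) (w : mp_space M) : option I :=
  match pselect (exists n : nat,
      (jump_time n w <= t%:E)%E /\ (t%:E < jump_time n.+1 w)%E) with
  | left ex_n => Some (mp_chain (sval (cid ex_n)) w)
  | right _ => None
  end.

Definition irreducible (R : realType) (I : countType) (q : I -> I -> R)
    (M : minimal_process q) : Prop :=
  forall x y : I, exists t : R,
    0 <= t /\ (0 < mp_prob M x [set w | mp_state t w = Some y])%E.

(* First time at or after the first jump at which the process is in x; +oo if  *)
(* there is none.                                                              *)
Definition return_time (R : realType) (I : countType) (q : I -> I -> R)
    (M : minimal_process q) (x : I) (w : mp_space M) : \bar R :=
  ereal_inf [set t%:E | t in
    [set t : R | (jump_time 1 w <= t%:E)%E /\ mp_state t w = Some x]].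

Definition positive_recurrent (R : realType) (I : countType) (q : I -> I -> R)
    (M : minimal_process q) : Prop :=
  forall x : I, exit_rate q x = 0 \/
    (\int[mp_prob M x]_w return_time x w < +oo)%E.

Definition ergodic (R : realType) (I : countType) (q : I -> I -> R)
    (M : minimal_process q) : Prop :=
  irreducible M /\ positive_recurrent M.

Definition system_rate (R : realType) (lambda : nat -> R) (mu1 mu2 : R)
    (x y : nat * nat) : R :=
  if y == (x.1.+1, x.2) then lambda x.2
  else if (0 < x.1)%N && (y == (x.1.-1, x.2.+1)) then mu1
  else if (0 < x.2)%N && (y == (x.1, x.2.-1)) then mu2
  else 0.

(* The law of the process is determined by the rates, so ergodicity does not   *)
(* depend on the realization; the existential also asserts that one exists.    *)
Definition stable (R : realType) (lambda : nat -> R) (mu1 mu2 : R) : Prop :=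
  exists M : minimal_process (system_rate lambda mu1 mu2), ergodic M.

(* [Some k] is the finite threshold k, [None] is K = infinity.                 *)
Definition threshold (R : realType) (K : option nat) (n : nat) : R :=
  if K is Some k then (if (n <= k)%N then 1 else 0) else 1.

Definition region (R : realType) (K : option nat) : set (R * R) :=
  [set mu | [/\ 0 < mu.1, 0 < mu.2 &
    if K is Some k then 1 - (mu.1 / mu.2) ^+ k.+1 < Num.min mu.1 mu.2
    else 1 < Num.min mu.1 mu.2]].

Arguments threshold : clear implicits.
Arguments region : clear implicits.

(* Main.v *)
Require Import Defs.
From mathcomp Require Import all_boot all_order all_algebra.
From mathcomp Require Import all_classical all_reals all_analysis.
From mathcomp Require Import ring lra zify measurable_realfun.
From HB Require Import structures.
Import Order.TTheory GRing.Theory Num.Theory.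
Import numFieldNormedType.Exports.

Set Implicit Arguments.
Unset Strict Implicit.
Unset Printing Implicit Defensive.

Local Open Scope classical_set_scope.
Local Open Scope ring_scope.

(** Whether the process is ergodic can be read off its jump chain. The exit rates lie
between two positive constants, so the mean return time to a state is finite if and only
if the jump chain needs finitely many steps on average to return
([integral_return_time_fin], [integrable_return_integral]). All states communicate, and
finiteness of the mean return time passes from one state to all those that it reaches
([integrable_return_reachable]). Hence stability means that the jump chain returns to
the empty state in finite mean time ([stable_return]).

Inside the region this follows from Foster's criterion ([foster]) with a Lyapunov
function x1 + g(x2). While the first queue is busy, the second one evolves like a
single-server queue with arrival rate mu1 and service rate mu2; the increments of g are
chosen to solve its Poisson equation ([slope]), which makes the drift a negative
constant where x1 > 0. Where x1 = 0 the drift is negative as soon as the increments of g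
exceed (input rate at large x2) / mu2; the increments solve a first-order recursion, and
the inequality that defines the region lets them reach this level
([threshold_return], [full_input_return]). From there on g is continued linearly
([slope_integrable_return]).

Conversely, let the mean return time be finite. The time spent in each state during an
excursion from the empty state is a finite invariant measure ([time_mean]), for which
rates across every cut balance. Cuts in x1 show that the mean input is less than mu1 in
proportion, cuts in x1 + x2 that it is less than mu2, and cuts in x2 that the mass of
x2 > n decays at least like (mu1 / mu2) ^ (n+1) ([mass_level_geometric]). For threshold K the
mean input is the fraction of time with x2 <= K, hence at least
1 - (mu1 / mu2) ^ (K+1), and this number is less than mu1 ([threshold_region]).

The process itself is built from one uniform number. Its binary digits of even and of odd
rank give two independent uniform numbers ([unif_split]): their joint distribution
function satisfies a functional equation that is a contraction. Repeating the splitting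
yields all the independent variables that the jumps and the holding times need
([path_law], [minimal_process_exists]). *)

(** * Return times of chains with finite range *)

Definition sup_bounded (R : realType) (I : Type) (f : I -> R) : Prop :=
  exists M : R, forall x, `|f x| <= M.

Section BoundedFun.
Variables (R : realType) (I : Type).
Implicit Types f g : I -> R.

Lemma sup_bounded_cst (c : R) : sup_bounded (fun _ : I => c).
Proof. by exists `|c|. Qed.

Lemma sup_boundedB f g : sup_bounded f -> sup_bounded g ->
  sup_bounded (fun x => f x - g x).
Proof.
move=> [M fM] [N gN]; exists (M + N) => x.
by rewrite (le_trans (ler_normB _ _)) ?lerD.
Qed.

Lemma sup_boundedD f g : sup_bounded f -> sup_bounded g ->
  sup_bounded (fun x => f x + g x).
Proof.
move=> [M fM] [N gN]; exists (M + N) => x.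
by rewrite (le_trans (ler_normD _ _)) ?lerD.
Qed.

Lemma sup_boundedM f g : sup_bounded f -> sup_bounded g ->
  sup_bounded (fun x => f x * g x).
Proof.
move=> [M fM] [N gN]; exists (M * N) => x.
by rewrite normrM ler_pM.
Qed.

Lemma sup_bounded_bool (b : I -> bool) : sup_bounded (fun x => (b x)%:R : R).
Proof. by exists 1 => x; case: (b x); rewrite ?normr1 ?normr0. Qed.

End BoundedFun.

Section FiniteRangeChain.
Variables (R : realType) (I : eqType) (P : I -> I -> R) (nbr : I -> seq I).
Hypothesis P_ge0 : forall x y, 0 <= P x y.
Hypothesis P_sum1 : forall x, \sum_(y <- nbr x) P x y = 1.
Implicit Types (f g : I -> R) (a x : I).

(** The seq [nbr x] carries the support of row x, so that the transition operator is
a finite sum and can be iterated without any summability condition. *)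
Definition step f x : R := \sum_(y <- nbr x) P x y * f y.

Definition killed (D : pred I) f : I -> R :=
  step (fun y => if D y then 0 else f y).

Definition taboo a : (I -> R) -> I -> R := killed (pred1 a).

(** [avoid a n x] is the probability that the chain started at x is not in a at any of
the times 1, ..., n. *)
Definition avoid a n : I -> R := iter n (taboo a) (fun _ => 1).

(** The sums are the tails of the first return time to a, added up: their
boundedness says that the expected number of steps before the return is finite. *)
Definition integrable_return a : Prop :=
  exists C : R, forall n, \sum_(i < n) avoid a i a <= C.

Lemma step_cst (c : R) x : step (fun _ => c) x = c.
Proof. by rewrite /step -big_distrl /= P_sum1 mul1r. Qed.

Lemma le_step f g x : (forall y, f y <= g y) -> step f x <= step g x.
Proof. by move=> fg; apply: ler_sum => y _; rewrite ler_wpM2l. Qed.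

Lemma stepD f g x : step (fun y => f y + g y) x = step f x + step g x.
Proof.
by rewrite /step -big_split; apply: eq_bigr => y _; rewrite mulrDr.
Qed.

Lemma stepZ (c : R) f x : step (fun y => c * f y) x = c * step f x.
Proof.
by rewrite /step big_distrr; apply: eq_bigr => y _; rewrite mulrCA.
Qed.

Lemma stepB f g x : step (fun y => f y - g y) x = step f x - step g x.
Proof.
rewrite (_ : (fun y => _) = (fun y => f y + (-1) * g y)); last first.
  by apply/funext => y; rewrite mulN1r.
by rewrite stepD stepZ mulN1r.
Qed.

(** First-step decomposition: either the next state is a, or the step is taboo. *)
Lemma stepE f a x :
  step f x = taboo a f x + f a * step (fun y => (y == a)%:R) x.
Proof.
rewrite -stepZ -stepD; congr step; apply/funext => y /=.
by case: eqP => [->|_]; rewrite ?mulr1 ?mulr0 ?add0r ?addr0.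
Qed.

Lemma le_taboo a f g x : (forall y, f y <= g y) -> taboo a f x <= taboo a g x.
Proof. by move=> fg; apply: le_step => y /=; case: eqP. Qed.

Lemma tabooD a f g x : taboo a (fun y => f y + g y) x = taboo a f x + taboo a g x.
Proof.
rewrite -stepD; congr step; apply/funext => y /=.
by case: eqP; rewrite ?addr0.
Qed.

Lemma tabooZ a (c : R) f x : taboo a (fun y => c * f y) x = c * taboo a f x.
Proof. by rewrite -stepZ; congr step; apply/funext => y /=; case: eqP; rewrite ?mulr0. Qed.

Lemma iter_tabooD a n f g x : iter n (taboo a) (fun y => f y + g y) x =
  iter n (taboo a) f x + iter n (taboo a) g x.
Proof.
elim: n x => //= n IH x; rewrite -tabooD; congr taboo; exact/funext.
Qed.

Lemma iter_tabooZ a n (c : R) f x : iter n (taboo a) (fun y => c * f y) x =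
  c * iter n (taboo a) f x.
Proof.
elim: n x => //= n IH x; rewrite -tabooZ; congr taboo; exact/funext.
Qed.

Lemma le_iter_taboo a n f g x : (forall y, f y <= g y) ->
  iter n (taboo a) f x <= iter n (taboo a) g x.
Proof. by elim: n x => //= n IH x fg; apply: le_taboo => y; exact: IH. Qed.

Lemma avoid_ge0 a n x : 0 <= avoid a n x.
Proof.
elim: n x => // n IH x; apply: sumr_ge0 => y _; rewrite mulr_ge0//=.
by case: eqP.
Qed.

Lemma avoid_le1 a n x : avoid a n x <= 1.
Proof.
elim: n x => // n IH x; rewrite -[leRHS](step_cst 1 x); apply: le_step => y /=.
by case: eqP.
Qed.

Lemma iter_taboo_bound a n f (M : R) x : (forall y, `|f y| <= M) ->
  `|iter n (taboo a) f x| <= M * avoid a n x.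
Proof.
move=> fM; rewrite ler_norml -mulNr -!iter_tabooZ; apply/andP; split;
by apply: le_iter_taboo => y; move: (fM y); rewrite ler_norml mulr1 => /andP[].
Qed.

Lemma iter_taboo0 a n x : iter n (taboo a) (fun=> 0) x = 0.
Proof.
rewrite -[RHS](mul0r (iter n (taboo a) (fun=> 0) x)) -iter_tabooZ.
by congr (iter _ _ _ _); apply/funext => y; rewrite mul0r.
Qed.

Lemma sum_avoid_recl a n x :
  \sum_(i < n.+1) avoid a i x = 1 + taboo a (fun y => \sum_(i < n) avoid a i y) x.
Proof.
rewrite big_ord_recl; congr (_ + _).
rewrite (eq_bigr (fun i : 'I_n => taboo a (avoid a i) x))//.
rewrite /taboo /killed /step.
rewrite exchange_big /=; apply: eq_bigr => y _.
by rewrite -big_distrr /=; case: eqP => // _; rewrite big1_eq.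
Qed.

(** Induction on n bounds the truncated expected hitting time of a from any other
state by V / eps: one step costs 1 and lowers V / eps by at least 1 on average. *)
Lemma foster a (V : I -> R) (eps : R) : 0 < eps -> (forall x, 0 <= V x) ->
  (forall x, x != a -> step V x <= V x - eps) -> integrable_return a.
Proof.
move=> e0 V0 drift.
have taboo_le n x : (forall y, y != a -> \sum_(i < n) avoid a i y <= V y / eps) ->
    taboo a (fun y => \sum_(i < n) avoid a i y) x <= eps^-1 * step V x.
  move=> IH; rewrite -stepZ; apply: le_step => y /=; case: eqP => [_|/eqP ya].
    by rewrite mulr_ge0// invr_ge0 ltW.
  by rewrite mulrC IH.
have bound n x : x != a -> \sum_(i < n) avoid a i x <= V x / eps.
  elim: n x => [x _|n IH x xa]; first by rewrite big_ord0 divr_ge0// ltW.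
  have := taboo_le n x IH; rewrite sum_avoid_recl.
  move=> /le_trans/(_ (ler_wpM2l _ (drift _ xa))).
  rewrite invr_ge0 ltW// => /(_ isT) h.
  by have := lerD (lexx 1) h; rewrite mulrBr mulVf ?gt_eqF//; lra.
exists (1 + eps^-1 * step V a) => -[|n].
  rewrite big_ord0 addr_ge0// mulr_ge0 ?invr_ge0 ?(ltW e0)//.
  by apply: sumr_ge0 => y _; rewrite mulr_ge0.
rewrite sum_avoid_recl lerD2l; apply: taboo_le => y; exact: bound.
Qed.

(** [occ a f] is the expected sum of f along an excursion from a, up to the step
before the return to a. As a functional of f it is the occupation measure of the
excursion, which need not be constructed as a measure. *)
Definition occ a f : R := limn (series (fun i => iter i (taboo a) f a)).

Section Occupation.
Variable a : I.
Hypothesis ra : integrable_return a.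

Lemma cvg_avoid : cvgn (series (fun i => avoid a i a)).
Proof.
apply: nondecreasing_is_cvgn.
  by apply/nondecreasing_seqP => n; rewrite seriesSr lerDl avoid_ge0.
have [C hC] := ra; exists C => _ [n _ <-].
by rewrite /series /= big_mkord.
Qed.

Lemma cvg_occ f : sup_bounded f ->
  series (fun i => iter i (taboo a) f a) @ \oo --> occ a f.
Proof.
move=> [M fM]; apply: normed_cvg.
apply: (@series_le_cvg _ _ (fun i => M * avoid a i a)) => [n|n|n|].
- exact: normr_ge0.
- by rewrite mulr_ge0 ?avoid_ge0// (le_trans _ (fM a)).
- exact: iter_taboo_bound.
- rewrite (_ : (fun i => _) = M *: (fun i => avoid a i a)).
    exact: is_cvg_seriesZ cvg_avoid.
  by apply/funext.
Qed.

Lemma occD f g : sup_bounded f -> sup_bounded g ->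
  occ a (fun x => f x + g x) = occ a f + occ a g.
Proof.
move=> bf bg; apply: cvg_lim => //.
rewrite (_ : series _ = series (fun i => iter i (taboo a) f a) +
   series (fun i => iter i (taboo a) g a)); first exact: cvgD (cvg_occ bf) (cvg_occ bg).
apply/funext => n; rewrite /series /= -[RHS]/(_ + _) -big_split /=.
by apply: eq_bigr => i _; rewrite iter_tabooD.
Qed.

Lemma occZ (c : R) f : sup_bounded f -> occ a (fun x => c * f x) = c * occ a f.
Proof.
move=> bf; apply: cvg_lim => //.
rewrite (_ : series _ = c *: series (fun i => iter i (taboo a) f a)).
  exact: cvgZr (cvg_occ bf).
apply/funext => n; rewrite /series /= -[RHS]/(_ * _) big_distrr /=.
by apply: eq_bigr => i _; rewrite iter_tabooZ.
Qed.

Lemma occB f g : sup_bounded f -> sup_bounded g ->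
  occ a (fun x => f x - g x) = occ a f - occ a g.
Proof.
move=> bf bg; rewrite -mulN1r -occZ// -occD//; last first.
  by apply: sup_boundedM => //; exact: sup_bounded_cst.
by congr occ; apply/funext => y; rewrite mulN1r.
Qed.

Lemma le_occ f g : sup_bounded f -> sup_bounded g -> (forall x, f x <= g x) ->
  occ a f <= occ a g.
Proof.
move=> bf bg fg; apply: ler_lim; [exact: cvgP (cvg_occ bf)|exact: cvgP (cvg_occ bg)|].
by apply: nearW => n; apply: ler_sum => i _; exact: le_iter_taboo.
Qed.

Lemma occ_cst0 : occ a (fun _ => 0) = 0.
Proof.
have b0 : sup_bounded (fun _ : I => 0 : R) by exact: sup_bounded_cst.
rewrite -[RHS](mul0r (occ a (fun=> 0))) -occZ//.
by congr occ; apply/funext => x; rewrite mul0r.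
Qed.

Lemma occ_ge0 f : sup_bounded f -> (forall x, 0 <= f x) -> 0 <= occ a f.
Proof. by move=> bf f0; rewrite -occ_cst0; apply: le_occ => //; exact: sup_bounded_cst. Qed.

(** The starting point is counted once, and a is not visited again before the end. *)
Lemma occ_start : occ a (fun x => (x == a)%:R) = 1.
Proof.
apply: cvg_lim => //; rewrite -cvg_shiftS.
apply: cvg_near_cst; apply: nearW => n.
rewrite /series /= big_nat_recl //= eqxx big1 ?addr0// => i _.
rewrite -[LHS]/(taboo a (iter i (taboo a) (fun x => (x == a)%:R)) a) -iterS iterSr.
rewrite (_ : taboo a _ = fun=> 0).
  exact: iter_taboo0.
apply/funext => x; rewrite /taboo /killed /step big1// => y _ /=.
by case: eqP => //; rewrite mulr0.
Qed.

Lemma sup_bounded_step f : sup_bounded f -> sup_bounded (step f).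
Proof.
move=> [M fM]; exists M => x; rewrite ler_norml.
rewrite -{1}(step_cst (- M) x) -[X in _ && (_ <= X)](step_cst M x).
by apply/andP; split; apply: le_step => y; move: (fM y); rewrite ler_norml => /andP[].
Qed.

(** Shifting the excursion by one step moves the mass f(a) of its starting point to
its end point, which is a again because the return is almost sure. The latter fact
is the same decomposition applied to the constant function 1. *)
Lemma occ_step f : sup_bounded f -> occ a (step f) = occ a f.
Proof.
move=> bf.
have shift g : sup_bounded g -> occ a (taboo a g) = occ a g - g a.
  move=> bg; apply: cvg_lim => //.
  have := cvg_occ bg; rewrite -cvg_shiftS => cg.
  suff -> : series (fun i => iter i (taboo a) (taboo a g) a) =
      (fun n => series (fun i => iter i (taboo a) g a) n.+1 - g a).
    exact: cvgB cg (cvg_cst (g a)).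
  apply/funext => n; rewrite /series /= big_nat_recl //= addrAC subrr add0r.
  by apply: eq_bigr => i _; rewrite -iterSr.
have bt g : sup_bounded g -> sup_bounded (taboo a g).
  move=> [M gM]; apply: sup_bounded_step; exists M => y /=; case: eqP => // _.
  by rewrite normr0 (le_trans _ (gM y)).
have b1 : sup_bounded (step (fun y => (y == a)%:R)).
  exact/sup_bounded_step/sup_bounded_bool.
have dec g : sup_bounded g -> occ a (step g) =
    occ a g - g a + g a * occ a (step (fun y => (y == a)%:R)).
  move=> bg; rewrite -shift// -occZ// -occD//; last 2 first.
  - exact: bt.
  - by apply: sup_boundedM => //; exact: sup_bounded_cst.
  by congr occ; apply/funext => x; exact: stepE.
(* The case f = 1 shows that the return happens with probability 1. *)
have := dec _ (sup_bounded_cst I 1).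
rewrite (_ : step (fun=> 1) = fun=> 1); last by apply/funext => x; exact: step_cst.
rewrite mul1r => h; rewrite dec//.
have -> : occ a (step (fun y => (y == a)%:R)) = 1 by lra.
lra.
Qed.

Definition reachable x y : Prop :=
  exists p, path (fun u v => (v \in nbr u) && (0 < P u v)) x p /\ last x p = y.

(** Invariance gives occ 1_z >= P x z * occ 1_x, so positivity spreads along edges. *)
Lemma occ_pos y : reachable a y -> 0 < occ a (fun x => (x == y)%:R).
Proof.
have bb z : sup_bounded (fun x : I => (x == z)%:R : R) by exact: sup_bounded_bool.
suff H p x : 0 < occ a (fun z => (z == x)%:R) ->
    path (fun u v => (v \in nbr u) && (0 < P u v)) x p ->
    0 < occ a (fun z => (z == last x p)%:R).
  by move=> [p [pp <-]]; apply: H => //; rewrite occ_start.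
elim: p x => //= z p IH x hx /andP[/andP[zx Pxz] pp]; apply: IH => //.
rewrite -occ_step// (@lt_le_trans _ _ (P x z * occ a (fun w => (w == x)%:R)))//.
  by rewrite mulr_gt0.
rewrite -occZ//; apply: le_occ => //.
- by apply: sup_boundedM => //; exact: sup_bounded_cst.
- exact: sup_bounded_step.
move=> w; case: eqP => [->|_]; last first.
  by rewrite mulr0; apply: sumr_ge0 => u _; rewrite mulr_ge0.
rewrite mulr1 /step (big_rem z)//= eqxx mulr1 lerDl.
by apply: sumr_ge0 => u _; rewrite mulr_ge0.
Qed.

(** The occupation measure of a is finite and invariant, and it charges y with some
mass c > 0. Invariance makes occ (avoid y n) decrease by exactly c * avoid y n y
from n to n+1, so c times the expected return time to y is at most occ 1. *)
Lemma integrable_return_reachable y : reachable a y -> integrable_return y.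
Proof.
move=> /occ_pos y_pos; set c := occ a _ in y_pos.
have ba n : sup_bounded (avoid y n).
  by exists 1 => x; rewrite ger0_norm ?avoid_ge0 ?avoid_le1.
have bb : sup_bounded (fun x : I => (x == y)%:R : R) by exact: sup_bounded_bool.
have decr n : occ a (avoid y n.+1) = occ a (avoid y n) - avoid y n y * c.
  rewrite -occZ// -occB//; last by apply: sup_boundedM => //; exact: sup_bounded_cst.
  rewrite -[RHS]occ_step; last first.
    apply: sup_boundedB => //; apply: sup_boundedM => //; exact: sup_bounded_cst.
  congr occ; apply/funext => x; congr step; apply/funext => z /=.
  by case: eqP => [->|_]; rewrite ?mulr1 ?subrr ?mulr0 ?subr0.
exists (occ a (fun=> 1) / c) => n; rewrite ler_pdivlMr//.
suff -> : occ a (fun=> 1) = (\sum_(i < n) avoid y i y) * c + occ a (avoid y n).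
  by rewrite lerDl occ_ge0// => x; exact: avoid_ge0.
elim: n => [|n IH]; first by rewrite big_ord0 mul0r add0r.
by rewrite IH big_ord_recr /= decr; ring.
Qed.

(** In i steps the rank grows by at most i, so rank n is only met from step n on, and
the expected length of the excursion beyond step n tends to 0. *)
Lemma occ_rank_tail (rank : I -> nat) (e : R) :
  rank a = 0%N -> (forall x y, y \in nbr x -> (rank y <= (rank x).+1)%N) ->
  0 < e -> exists n, occ a (fun x => (n <= rank x)%:R) <= e.
Proof.
move=> ra0 rankS e_gt0.
have vanish n i x : (rank x + i < n)%N ->
    iter i (taboo a) (fun y => (n <= rank y)%:R) x = 0.
  elim: i x => [|i IH] x; first by rewrite addn0 ltnNge /= => /negbTE ->.
  move=> h; rewrite /= /taboo /killed /step big_seq big1// => y /rankS ry.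
  by case: ifP => _; rewrite ?mulr0// IH ?mulr0// (leq_ltn_trans _ h)// addnS -addSn leq_add2r.
have tail n : occ a (fun x => (n <= rank x)%:R) <=
    occ a (fun=> 1) - series (fun i => avoid a i a) n.
  apply: limr_le; first exact/cvgP/cvg_occ/sup_bounded_bool.
  exists n => // N /= nN.
  apply: (@le_trans _ _ (series (fun i => avoid a i a) N - series (fun i => avoid a i a) n)).
    rewrite sub_series_geq// /series /= (@big_cat_nat _ _ _ n)//= big_nat big1 ?add0r.
      by apply: ler_sum => i _; apply: le_iter_taboo => y; case: (n <= rank y)%N.
    by move=> i /= ni; rewrite vanish// ra0.
  rewrite lerD2r; apply: nondecreasing_cvgn_le; last exact: cvg_avoid.
  by apply/nondecreasing_seqP => k; rewrite seriesSr lerDl avoid_ge0.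
have /cvgrPdist_le/(_ e e_gt0)[n _ /(_ n (leqnn n)) /=] := cvg_occ (sup_bounded_cst I 1).
move=> h; exists n; apply: le_trans (tail n) _.
exact: le_trans (ler_norm _) h.
Qed.

End Occupation.
End FiniteRangeChain.

(** * Measurability and integration complements *)

Section MeasureComplements.
Context d (T : measurableType d) (R : realType).

Lemma measurable_forall_nat (Q : nat -> T -> Prop) :
  (forall i, measurable [set w | Q i w]) -> measurable [set w | forall i, Q i w].
Proof.
move=> mQ; rewrite (_ : [set w | _] = \bigcap_i [set w | Q i w]).
  exact: bigcapT_measurable.
by apply/seteqP; split => w /=; [move=> h i _; exact: h|move=> h i; exact: h].
Qed.

Lemma measurable_imply (b : bool) (Q : T -> Prop) :
  measurable [set w | Q w] -> measurable [set w | b -> Q w].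
Proof.
case: b => mQ.
  by rewrite (_ : [set w | _] = [set w | Q w])//; apply/seteqP; split => w /=; [apply|].
by rewrite (_ : [set w | _] = setT)//; apply/seteqP; split => w.
Qed.

(** Sigma-additivity along a countable partition of which only finitely many pieces
have positive measure. *)
Lemma measure_fibers (mu : {measure set T -> \bar R}) (I : countType)
    (Y : T -> I) (A : set T) (s : seq I) :
  (forall y, measurable [set w | Y w = y]) -> measurable A -> uniq s ->
  (forall y, y \notin s -> mu (A `&` [set w | Y w = y]) = 0%E) ->
  mu A = (\sum_(y <- s) mu (A `&` [set w | Y w = y]))%E.
Proof.
move=> mY; elim: s A => [|y s IH] A mA /= us null; last first.
  case/andP: us => ys us; rewrite big_cons.
  have mAy : measurable (A `&` [set w | Y w = y]) by exact: measurableI.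
  rewrite -{1}(setIT A) -(setUCr [set w | Y w = y]) setIUr measureU//; last 2 first.
  - by apply: measurableI => //; exact: measurableC.
  - by rewrite setIACA setICr setI0.
  congr (_ + _)%E; apply: (etrans (IH _ _ us _)).
  - by apply: measurableI => //; exact: measurableC.
  - move=> z zs; have [->|zy] := eqVneq z y.
      by rewrite -setIA setICl setI0 measure0.
    rewrite -(null z) ?inE ?negb_or ?zy//; congr (mu _).
    apply/seteqP; split => w /=; first by move=> [[]].
    by move=> [? Yz]; do !split => //; rewrite Yz; exact/eqP.
  rewrite big_seq [RHS]big_seq; apply: eq_bigr => z zs; congr (mu _).
  apply/seteqP; split => w /= [].
    by move=> [? _] ?.
  move=> Aw Yz; do !split => //; rewrite Yz => zy.
  by move: ys; rewrite -zy zs.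
rewrite big_nil.
pose F n := if unpickle n is Some y then A `&` [set w | Y w = y] else set0.
have mF n : measurable (F n) by rewrite /F; case: unpickle => // y; exact: measurableI.
have AF : A `<=` \bigcup_n F n.
  by move=> w Aw; exists (pickle (Y w)) => //; rewrite /F pickleK.
apply/eqP; rewrite eq_le measure_ge0 andbT.
apply: (le_trans (measure_sigma_subadditive _ mF mA AF)).
rewrite eseries0// => n _ _.
by rewrite /F; case: unpickle => [y|]; rewrite ?measure0// null.
Qed.

Import HBNNSimple.

(** The integral of a nonnegative function is defined as a supremum over simple
functions below it, hence is monotone for arbitrary functions: this allows
comparisons with return times without proving that these are measurable. *)
Lemma le_nonneg_integral (mu : {measure set T -> \bar R}) (f g : T -> \bar R) :
  (forall w, (0 <= f w)%E) -> (forall w, (f w <= g w)%E) ->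
  (\int[mu]_w f w <= \int[mu]_w g w)%E.
Proof.
move=> f0 fg; have g0 w : (0 <= g w)%E by exact: le_trans (f0 w) (fg w).
rewrite !ge0_integralTE//; apply: le_ereal_sup => _ [h /= hf <-].
by exists h => // w; exact: le_trans (hf w) (fg w).
Qed.

(** Discrete layer-cake bound: the sum is s rounded up. *)
Lemma le_sum_levels (s : \bar R) : (0 <= s)%E ->
  (s <= \sum_(k <oo) (if (k%:R%:E < s)%E then 1 else 0))%E.
Proof.
move=> s0; pose u k : \bar R := if (k%:R%:E < s)%E then 1%E else 0%E.
rewrite -[leRHS]/(\sum_(k <oo) u k)%E.
have u0 k : (0 <= u k)%E by rewrite /u; case: ifP.
have part n : (forall k, (k < n)%N -> u k = 1%E) -> (n%:R%:E <= \sum_(k <oo) u k)%E.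
  move=> h; apply: le_trans (nneseries_lim_ge n _) => //.
  rewrite big_mkord (eq_bigr (fun=> 1%:E)) => [|i _]; last by rewrite h.
  by rewrite sumEFin sumr_const card_ord.
case: s s0 @u u0 part => [r r0|_|//] u u0 part.
  pose n := Num.truncn r.
  have [nr rn] : n%:R <= r /\ r < n.+1%:R by apply/andP; rewrite truncn_itv.
  have [<-|nr'] := eqVneq n%:R r.
    apply: part => k kn; rewrite /u lte_fin ifT//.
    by rewrite (lt_le_trans _ nr)// ltr_nat.
  apply: (@le_trans _ _ n.+1%:R%:E); first by rewrite lee_fin ltW.
  apply: part => k; rewrite ltnS => kn; rewrite /u lte_fin ifT//.
  rewrite (@le_lt_trans _ _ n%:R)// ?ler_nat//.
  by rewrite lt_neqAle nr' nr.
rewrite leye_eq; apply/eqP/eqyP => r r0.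
apply: (@le_trans _ _ (Num.truncn r).+1%:R%:E).
  by rewrite lee_fin ltW// truncnS_gt.
by apply: part => k _; rewrite /u ltry.
Qed.

End MeasureComplements.

(** * From the jump chain to the continuous-time process *)

Section MinimalProcess.
Variables (R : realType) (I : countType) (q : I -> I -> R) (nbr : I -> seq I).
Variable M : minimal_process q.
Notation P := (jump_prob q).
Notation chain := (@mp_chain R I q M).
Notation hold := (@mp_hold R I q M).
Notation jtime := (@jump_time R I q M).
Notation "'Pr_' x" := (@mp_prob R I q M x) (at level 8, x at level 2).

Hypothesis P_ge0 : forall x y, 0 <= P x y.
Hypothesis P_sum1 : forall x, \sum_(y <- nbr x) P x y = 1.
Hypothesis nbr_uniq : forall x, uniq (nbr x).
Hypothesis P_nbr : forall x y, y \notin nbr x -> P x y = 0.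
Variables (qmin qmax : R).
Hypothesis qmin_gt0 : 0 < qmin.
Hypothesis qmin_le : forall x, qmin <= exit_rate q x.
Hypothesis le_qmax : forall x, exit_rate q x <= qmax.

Lemma measurable_chain (Q : pred I) n : measurable [set w | Q (chain n w)].
Proof.
pose F k := if unpickle k is Some y then
   if Q y then [set w | chain n w = y] else set0 else set0.
rewrite (_ : [set w | _] = \bigcup_k F k).
  apply: bigcupT_measurable => k; rewrite /F; case: unpickle => // y.
  by case: ifP => // _; exact: mp_chain_meas.
apply/seteqP; split => w /= => [Qw|[k _]].
  by exists (pickle (chain n w)) => //; rewrite /F pickleK Qw.
by rewrite /F; case: unpickle => // y; case: ifP => // Qy /= ->.
Qed.

Lemma measurable_chain_eq n y : measurable [set w | chain n w = y].
Proof. exact: mp_chain_meas. Qed.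

Lemma measurable_hold_gt n (t : R) : measurable [set w | (t%:E < hold n w)%E].
Proof.
rewrite -[X in measurable X]setTI; apply: emeasurable_fun_o_infty => //.
exact: mp_hold_meas.
Qed.

(** The path is prescribed up to time m, then has to stay outside D up to time n. The
holding times before the last one are only required to be positive, which is an
event of probability 1, and the last one exceeds t. *)
Definition cylinder (D : pred I) (y : nat -> I) (m n : nat) (t : R) :
    set (mp_space M) :=
  [set w | (forall i, (i <= m)%N -> chain i w = y i) /\
           (forall i, (m < i <= n)%N -> ~~ D (chain i w)) /\
           (forall i, (i < n)%N -> (0%:E < hold i w)%E) /\ (t%:E < hold n w)%E].

Lemma measurable_cylinder D y m n t : measurable (cylinder D y m n t).
Proof.
apply: measurableI; last apply: measurableI; last apply: measurableI.
- by apply: measurable_forall_nat => i; apply: measurable_imply; exact: measurable_chain_eq.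
- apply: measurable_forall_nat => i; apply: measurable_imply.
  exact: (measurable_chain (predC D)).
- by apply: measurable_forall_nat => i; apply: measurable_imply; exact: measurable_hold_gt.
- exact: measurable_hold_gt.
Qed.

(** The expectation of exp (- q t), with q the exit rate of the k-th state, on the
event that the chain avoids D during k steps. *)
Definition survival (D : pred I) (t : R) (k : nat) : I -> R :=
  iter k (killed P nbr D) (fun z => expR (- (exit_rate q z * t))).

(** Downward induction on the length of the prescribed path: the event splits
according to the first free state, and k = 0 is the law of the process. *)
Lemma cylinder_prob x D y m k t : 0 <= t ->
  Pr_ x (cylinder D y m (m + k) t) =
  ((x == y 0%N)%:R * (\prod_(i < m) P (y i) (y i.+1)) * survival D t k (y m))%:E.
Proof.
move=> t0; elim: k m y => [|k IH] m y.
  rewrite addn0 /survival /=.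
  (* The law of the process is used with the levels 0, ..., 0, t. *)
  pose t' i := if i == m then t else 0.
  have t'0 i : 0 <= t' i by rewrite /t'; case: ifP.
  have -> : cylinder D y m m t = [set w | forall i, (i <= m)%N ->
     chain i w = y i /\ ((t' i)%:E < hold i w)%E].
    apply/seteqP; split => w /=.
      move=> [cy [_ [h ht]]] i im; split; first exact: cy.
      rewrite /t'; case: eqP => [->//|/eqP ne]; apply: h.
      by rewrite ltn_neqAle ne im.
    move=> h; split; first by move=> i /h[].
    split; first by move=> i /andP[/leq_trans H /H]; rewrite ltnn.
    split; last by have [_] := h m (leqnn m); rewrite /t' eqxx.
    by move=> i im; have [_] := h i (ltnW im); rewrite /t' (ltn_eqF im).
  rewrite mp_law//; congr (_ * _)%:E.
  rewrite big_ord_recr /= /t' eqxx big1 ?mul1r// => i _.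
  by rewrite (ltn_eqF (ltn_ord i)) mulr0 oppr0 expR0.
(* Fixing the state at time m+1 extends the prescribed path by one state. *)
pose upd z i := if (i <= m)%N then y i else z.
have fibre z : cylinder D y m (m + k.+1) t `&` [set w | chain m.+1 w = z] =
    if D z then set0 else cylinder D (upd z) m.+1 (m.+1 + k) t.
  case: ifPn => Dz; apply/seteqP; split => w //=.
    move=> [[_ [nD _]] cz]; have := nD m.+1; rewrite ltnSn addnS ltnS leq_addr.
    by move=> /(_ isT); rewrite cz Dz.
    move=> [[cy [nD h]] cz]; rewrite -addSnnS in nD h; split; last split => //.
      move=> i; rewrite leq_eqVlt ltnS /upd => /predU1P[->|im].
        by rewrite ltnn.
      by rewrite im cy.
    by move=> i /andP[/ltnW mi ik]; rewrite nD// mi.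
  move=> [cy [nD h]]; have cz : chain m.+1 w = z by rewrite cy// /upd ltnn.
  rewrite -addSnnS; split=> //; split; last split => //.
    by move=> i im; rewrite cy 1?ltnW// /upd im.
  move=> i /andP[]; rewrite leq_eqVlt => /predU1P[<-|mi] ik; first by rewrite cz.
  by rewrite nD// mi.
have fprob z : Pr_ x (cylinder D y m (m + k.+1) t `&` [set w | chain m.+1 w = z]) =
    ((x == y 0%N)%:R * (\prod_(i < m) P (y i) (y i.+1)) *
     (P (y m) z * (if D z then 0 else survival D t k z)))%:E.
  rewrite fibre; case: ifP => Dz; first by rewrite measure0 !mulr0.
  have um : upd z m = y m by rewrite /upd leqnn.
  have um1 : upd z m.+1 = z by rewrite /upd ltnn.
  rewrite IH big_ord_recr /= um um1; congr (_%:E).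
  rewrite (eq_bigr (fun i : 'I_m => P (y i) (y i.+1))); last first.
    by move=> i _; rewrite /upd (ltnW (ltn_ord i)) ltn_ord.
  by rewrite /upd leq0n; ring.
rewrite (measure_fibers (measurable_chain_eq m.+1) _ (nbr_uniq (y m))); last 2 first.
- exact: measurable_cylinder.
- by move=> z zn; apply: (etrans (fprob z)); rewrite P_nbr// mul0r mulr0.
rewrite (eq_bigr _ (fun z _ => fprob z)).
by rewrite sumEFin -big_distrr.
Qed.

Definition alive (D : pred I) x n t := cylinder D (fun=> x) 0 n t.

Lemma alive_prob D x n t : 0 <= t -> Pr_ x (alive D x n t) = (survival D t n x)%:E.
Proof.
move=> t0; rewrite /alive -{1}(add0n n) cylinder_prob//.
by rewrite eqxx big_ord0 !mul1r.
Qed.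

(** The exit rates lie between qmin and qmax. *)
Lemma survival_taboo a t n x : 0 <= t ->
  expR (- (qmax * t)) * avoid P nbr a n x <= survival (pred1 a) t n x
  <= expR (- (qmin * t)) * avoid P nbr a n x.
Proof.
move=> t0; rewrite /avoid -!iter_tabooZ.
rewrite /survival -/(taboo P nbr a).
apply/andP; split; apply: (@le_iter_taboo _ _ P nbr P_ge0 a n) => z.
  by rewrite mulr1 ler_expR lerN2 ler_wpM2r.
by rewrite mulr1 ler_expR lerN2 ler_wpM2r.
Qed.

(** Without killing and at level 0 nothing is lost, since the rows of P sum to 1. *)
Lemma survival_full n x : survival pred0 0 n x = 1.
Proof.
elim: n x => [x|n IH x]; first by rewrite /survival /= mulr0 oppr0 expR0.
rewrite /survival /= /killed /= (_ : iter _ _ _ = fun=> 1).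
  exact: step_cst.
exact/funext.
Qed.

(** Paths that start at x and make no instantaneous jump. *)
Definition regular x : set (mp_space M) :=
  [set w | chain 0 w = x /\ forall n, (0%:E < hold n w)%E].

Lemma measurable_regular x : measurable (regular x).
Proof.
apply: measurableI; first exact: measurable_chain_eq.
by apply: measurable_forall_nat => n; exact: measurable_hold_gt.
Qed.

Lemma regular_null x : Pr_ x (~` regular x) = 0%E.
Proof.
pose F n := ~` alive pred0 x n 0.
have mF n : measurable (F n) by apply: measurableC; exact: measurable_cylinder.
have cov : ~` regular x `<=` \bigcup_n F n.
  move=> w /= nr; apply: contrapT => nF; apply: nr.
  have h n : alive pred0 x n 0 w.
    by apply: contrapT => nw; apply: nF; exists n.
  split; first by have [-> //] := h 0%N.
  by move=> n; have [_ [_ []]] := h n.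
apply/eqP; rewrite eq_le measure_ge0 andbT.
have mr : measurable (~` regular x) by apply: measurableC; exact: measurable_regular.
apply: (le_trans (measure_sigma_subadditive _ mF mr cov)).
rewrite eseries0// => n _ _.
apply: (etrans (probability_setC (Pr_ x) (measurable_cylinder _ _ _ _ _))).
by rewrite -/(alive _ _ _ _) alive_prob// survival_full subee.
Qed.

Lemma jump_time_ge0 n w : (0 <= jtime n w)%E.
Proof. by rewrite /jump_time sume_ge0// => i _; exact: mp_hold_ge0. Qed.

Lemma jump_time_recr n w : jtime n.+1 w = (jtime n w + hold n w)%E.
Proof. by rewrite /jump_time big_nat_recr. Qed.

Lemma jump_time_le m n w : (m <= n)%N -> (jtime m w <= jtime n w)%E.
Proof.
move=> /subnK <-; elim: (n - m)%N => // k IH.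
by rewrite addSn jump_time_recr (le_trans IH)// leeDl// mp_hold_ge0.
Qed.

(** Jump times are nondecreasing, so at most one n satisfies the two inequalities. *)
Lemma mp_stateP n t w : (jtime n w <= t%:E)%E -> (t%:E < jtime n.+1 w)%E ->
  mp_state t w = Some (chain n w).
Proof.
move=> nt tn; rewrite /mp_state; case: pselect => [ex_n|[]]; last by exists n.
case: (cid _) => /= m [mt tm]; congr (Some (chain _ w)).
apply/eqP; rewrite eqn_leq; apply/andP; split; rewrite leqNgt; apply/negP => lt.
- by have := lt_le_trans tn (le_trans (jump_time_le w lt) mt); rewrite ltxx.
- by have := lt_le_trans tm (le_trans (jump_time_le w lt) nt); rewrite ltxx.
Qed.

Lemma mp_state_inv t w x : mp_state t w = Some x -> exists n,
  [/\ (jtime n w <= t%:E)%E, (t%:E < jtime n.+1 w)%E & chain n w = x].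
Proof.
rewrite /mp_state; case: pselect => // ex_n [<-].
by case: (cid _) => /= n [? ?]; exists n.
Qed.

Lemma measurable_jump_time n : measurable_fun [set: mp_space M] (jtime n).
Proof.
apply: emeasurable_sum => i.
exact: mp_hold_meas.
Qed.

Lemma measurable_mp_state t x : measurable [set w | @mp_state R I q M t w = Some x].
Proof.
rewrite (_ : [set w | _] = \bigcup_n ([set w | (jtime n w <= t%:E)%E] `&`
   [set w | (t%:E < jtime n.+1 w)%E] `&` [set w | chain n w = x])).
  apply: bigcupT_measurable => n; apply: measurableI; last exact: measurable_chain_eq.
  apply: measurableI; rewrite -[X in measurable X]setTI.
    by apply: emeasurable_fun_infty_c => //; exact: measurable_jump_time.
  by apply: emeasurable_fun_o_infty => //; exact: measurable_jump_time.
apply/seteqP; split => w /=.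
  by move=> /mp_state_inv[n [? ? ?]]; exists n.
by move=> [n _ [[h1 h2] <-]]; exact: mp_stateP.
Qed.

(** Along a path of n edges from x to z, let the first n holding times be at most k and
the last one exceed n k: then the process is in z at time n k. Given the path and the
last holding time, the first requirement fails with probability at most
n exp (- qmin k), which is below 1 for k = n / qmin. *)
Lemma irreducible_reachable :
  (forall x y, reachable P nbr x y) -> irreducible M.
Proof.
move=> reach x z; have [p [pp lp]] := reach x z.
pose n := size p; pose y i := nth x (x :: p) i.
pose c := \prod_(i < n) P (y i) (y i.+1).
have c_gt0 : 0 < c.
  by apply: prodr_gt0 => i _; have /andP[] := pathP x pp i (ltn_ord i).
have yn : y n = z by rewrite /y -lp (last_nth x).
pose k : R := n%:R / qmin.
have k_ge0 : 0 <= k by rewrite divr_ge0// ltW.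
pose e := expR (- (exit_rate q z * (n%:R * k))).
(* Level n k for the last holding time, u for the j-th one, 0 for the others; for j = n
the level u disappears. *)
pose tl (u : R) (j i : nat) : R := if i == n then n%:R * k else if i == j then u else 0.
have tl_ge0 u j i : 0 <= u -> 0 <= tl u j i.
  by rewrite /tl => u0; case: ifP => _; [rewrite mulr_ge0|case: ifP].
pose ev u j : set (mp_space M) := [set w | forall i, (i <= n)%N ->
  chain i w = y i /\ ((tl u j i)%:E < hold i w)%E].
have mev u j : measurable (ev u j).
  apply: measurable_forall_nat => i; apply: measurable_imply.
  by apply: measurableI; [exact: measurable_chain_eq|exact: measurable_hold_gt].
have prob u j : 0 <= u -> (j < n)%N ->
    Pr_ x (ev u j) = (c * e * expR (- (exit_rate q (y j) * u)))%:E.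
  move=> u0 jn; rewrite mp_law; last by move=> i; exact: tl_ge0.
  rewrite eqxx mul1r big_ord_recr /= /tl eqxx yn -/c -/e.
  rewrite (bigD1 (Ordinal jn))//= (ltn_eqF jn) eqxx big1 ?mulr1; last first.
    move=> i ij; rewrite (ltn_eqF (ltn_ord i)) ifF ?mulr0 ?oppr0 ?expR0//.
    by apply/negbTE; apply: contra ij => /eqP h; apply/eqP/val_inj.
  by congr (_%:E); ring.
have prob0 : Pr_ x (ev 0 n) = (c * e)%:E.
  rewrite mp_law; last by move=> i; exact: tl_ge0.
  rewrite eqxx mul1r big_ord_recr /= /tl eqxx yn -/c -/e big1 ?mul1r//.
  by move=> i _; rewrite (ltn_eqF (ltn_ord i)) mulr0 oppr0 expR0.
exists (n%:R * k); split; first by rewrite mulr_ge0.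
set S := [set w | _ = Some z].
have mS : measurable S by exact: measurable_mp_state.
have sub : ev 0 n `<=` S `|` \big[setU/set0]_(j < n) ev k j.
  move=> w evw; have [[j jn kj]|small] := pselect (exists2 j, (j < n)%N & (k%:E < hold j w)%E).
    right; rewrite -bigcup_mkord; exists j => // i im; have [cw hw] := evw i im.
    split=> //; move: hw; rewrite /tl; case: eqP => // _.
    by case: eqP => [->|].
  left; rewrite /S /= -yn; have [<- hn] := evw n (leqnn n); apply: mp_stateP.
    have -> : (n%:R * k)%:E = (\sum_(0 <= i < n) k%:E)%E.
      by rewrite big_mkord sumEFin sumr_const card_ord mulr_natl.
    rewrite /jump_time !big_mkord; apply: lee_sum => i _; rewrite leNgt.
    by apply/negP => lt; apply: small; exists i.
  rewrite jump_time_recr; move: hn; rewrite /tl eqxx => /lt_le_trans; apply.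
  by rewrite leeDr// jump_time_ge0.
have mB : measurable (\big[setU/set0]_(j < n) ev k j) by exact: bigsetU_measurable.
rewrite lt0e measure_ge0 andbT; apply/eqP => S0.
have := le_measure (Pr_ x) (mem_set (mev 0 n)) (mem_set (measurableU _ _ mS mB)) sub.
move=> /le_trans/(_ (measureU2 _ mS mB)); rewrite [X in (X + _)%E]S0 add0e.
move=> /le_trans/(_ (Boole_inequality _ (fun j _ => mev k j))).
rewrite [X in (X <= _)%E]prob0 (eq_bigr (fun j : 'I_n =>
    (c * e * expR (- (exit_rate q (y j) * k)))%:E)); last first.
  by move=> j _; exact: prob.
have ce : 0 < c * e by rewrite mulr_gt0// expR_gt0.
rewrite sumEFin lee_fin -big_distrr /= -[leLHS]mulr1 ler_pM2l//.
apply/negP; rewrite -ltNge.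
apply: (@le_lt_trans _ _ (\sum_(j < n) expR (- n%:R))).
  apply: ler_sum => j _; rewrite ler_expR lerN2 /k mulrCA ler_peMr//.
  by rewrite ler_pdivlMr// mul1r.
rewrite sumr_const card_ord -[ltLHS]mulr_natl expRN ltr_pdivrMr ?expR_gt0// mul1r.
by have := expR_ge1Dx (n%:R : R); lra.
Qed.

Lemma return_time_ge0 x w : (0 <= @return_time R I q M x w)%E.
Proof.
apply: le_ereal_inf_tmp => _ [t [h _] <-]; apply: le_trans h.
exact: jump_time_ge0.
Qed.

(** Before its first return, the process has spent at least the holding times of the
states visited so far; h i has to vanish as soon as x was met at a step in 1..i. *)
Lemma le_return_time x w (h : (\bar R)^nat) :
  (forall i, (0 <= h i)%E) -> (forall i, (h i <= hold i w)%E) ->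
  (forall i m, (0 < m)%N -> (m <= i)%N -> chain m w = x -> h i = 0%E) ->
  (\sum_(i <oo) h i <= @return_time R I q M x w)%E.
Proof.
move=> h0 hh hz; apply: le_ereal_inf_tmp => _ [t [h1 st] <-].
have [m [mt tm cm]] := mp_state_inv st.
have m_gt0 : (0 < m)%N.
  by rewrite lt0n; apply/eqP => m0; move: tm; rewrite m0 => /lt_le_trans/(_ h1); rewrite ltxx.
apply: le_trans mt; apply: lime_le; first exact: is_cvg_nneseries.
apply: nearW => n.
suff : (\sum_(0 <= i < n) h i <= jtime (minn n m) w)%E.
  by move=> /le_trans; apply; apply: jump_time_le; exact: geq_minr.
elim: n => [|n IH]; first by rewrite big_nil jump_time_ge0.
rewrite big_nat_recr//=; have [mn|nm] := leqP m n.
  rewrite (hz n m)// adde0 (le_trans IH)// jump_time_le//.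
  by rewrite leq_min geq_minr andbT (leq_trans (geq_minl _ _)).
rewrite (minn_idPl nm) jump_time_recr leeD//.
by move: IH; rewrite (minn_idPl (ltnW nm)).
Qed.

(** On a regular path that returns at step N, the process is in x at the N-th jump time,
the sum of the first N holding times. If the chain never returns, the right-hand
side is infinite because all its terms are at least 1. *)
Lemma return_time_le x w (h : (\bar R)^nat) : regular x w ->
  (forall i, (0 <= h i)%E) ->
  (forall i, (forall j, (0 < j <= i)%N -> chain j w != x) ->
     (hold i w <= h i)%E /\ (1 <= h i)%E) ->
  (@return_time R I q M x w <= \sum_(i <oo) h i)%E.
Proof.
move=> [c0 hpos] h0 hh.
have [ex|nex] := pselect (exists n, (0 < n)%N && (chain n w == x)); last first.
  rewrite (_ : (\sum_(i <oo) h i)%E = +oo%E) ?leey//.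
  apply/eqyP => r r0; apply: (@le_trans _ _ (Num.truncn r).+1%:R%:E).
    by rewrite lee_fin ltW// truncnS_gt.
  apply: le_trans (nneseries_lim_ge (Num.truncn r).+1 _) => //.
  rewrite (_ : _%:R%:E = (\sum_(0 <= i < (Num.truncn r).+1) 1%:E)%E); last first.
    by rewrite big_mkord sumEFin sumr_const card_ord.
  apply: lee_sum => i _; have [] // := hh i.
  move=> j /andP[j0 _]; apply/negP => cj; apply: nex; exists j.
  by rewrite j0.
pose N := ex_minn ex; have [N0 cN minN] : [/\ (0 < N)%N, chain N w == x &
   forall j, (0 < j)%N -> chain j w == x -> (N <= j)%N].
  rewrite /N; case: ex_minnP => m /andP[m0 cm] mm; split=> // j j0 cj.
  by apply: mm; rewrite j0.
apply: (@le_trans _ _ (jtime N w)); last first.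
  apply: le_trans (nneseries_lim_ge N _) => //.
  rewrite /jump_time !big_mkord; apply: lee_sum => i _; apply: (hh i _).1 => j.
  move=> /andP[j0 ji]; apply/negP => cj.
  by have := leq_ltn_trans (leq_trans (minN _ j0 cj) ji) (ltn_ord i); rewrite ltnn.
case E : (jtime N w) (jump_time_ge0 N w) => [t| |]// t0; last by rewrite leey.
apply: ereal_inf_lbound; exists t => //; split.
  by rewrite -E; exact: jump_time_le.
rewrite -(eqP cN); apply: mp_stateP; rewrite ?E// jump_time_recr E.
by rewrite lteDl.
Qed.

Lemma integral_indic_series x (A : nat -> set (mp_space M)) :
  (forall i, measurable (A i)) ->
  (\int[Pr_ x]_w (\sum_(i <oo) (\1_(A i) w)%:E) = \sum_(i <oo) Pr_ x (A i))%E.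
Proof.
move=> mA; rewrite integral_nneseries//.
  by apply: eq_eseriesr => i _; rewrite integral_indic// setIT.
by move=> i; apply/measurable_EFinP; exact: measurable_indic.
Qed.

(** The return time is at least the number of steps i before the return whose holding
time exceeds 1, and such a holding time has probability at least exp (- qmax). *)
Lemma integral_return_time_fin x :
  (\int[Pr_ x]_w @return_time R I q M x w < +oo)%E -> integrable_return P nbr x.
Proof.
move=> fin.
have bound : (\sum_(i <oo) Pr_ x (alive (pred1 x) x i 1) < +oo)%E.
  apply: le_lt_trans fin; rewrite -integral_indic_series; last first.
    by move=> i; exact: measurable_cylinder.
  apply: le_nonneg_integral => w.
    by apply: nneseries_ge0 => i _ _; rewrite lee_fin.
  apply: le_return_time => i; rewrite ?lee_fin// indicE.
    case: (boolP (w \in _)) => [|_]; last exact: mp_hold_ge0.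
    by rewrite inE => -[_ [_ [_ /ltW]]].
  move=> m m0 mi cm; rewrite memNset// => -[_ [na _]].
  by have := na m; rewrite m0 mi cm /= eqxx => /(_ isT).
exists (expR (qmax * 1) * fine (\sum_(i <oo) Pr_ x (alive (pred1 x) x i 1))) => n.
rewrite -ler_pdivrMl ?expR_gt0// -expRN -lee_fin fineK; last first.
  by rewrite ge0_fin_numE// nneseries_ge0.
apply: le_trans (nneseries_lim_ge n _); last by [].
rewrite big_mkord big_distrr /= -sumEFin; apply: lee_sum => i _.
by rewrite alive_prob// lee_fin; have /andP[] := survival_taboo x i x (@ler01 R).
Qed.

Lemma cvg_geometric_expR : exists2 C : R, 0 <= C & forall n,
  \sum_(k < n) expR (- (qmin * k%:R)) <= C.
Proof.
pose r := expR (- qmin); have r1 : r < 1 by rewrite -expR0 ltr_expR oppr_lt0.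
exists (1 - r)^-1 => [|n]; first by rewrite invr_ge0 subr_ge0 ltW.
rewrite -[leLHS]mulr1 -[X in _ * X](@mulfV _ (1 - r)) ?gt_eqF ?subr_gt0//.
rewrite mulrA ler_piMl// ?invr_ge0 ?subr_ge0 ?(ltW r1)//.
rewrite (eq_bigr (fun k : 'I_n => r ^+ k)) => [|k _]; last first.
  by rewrite /r -expRM_natr mulNr.
have rn : 0 <= r ^+ n by rewrite exprn_ge0// expR_ge0.
by have := subrX1 r n; lra.
Qed.

(** Each holding time is at most the number of integers below it, and the level k is
exceeded with probability at most exp (- qmin k). The null set of irregular paths is
covered by an infinite sum of copies of its indicator function. *)
Lemma integrable_return_integral x : integrable_return P nbr x ->
  (\int[Pr_ x]_w @return_time R I q M x w < +oo)%E.
Proof.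
move=> [C hC]; pose A i k := alive (pred1 x) x i k%:R.
have mA i k : measurable (A i k) by exact: measurable_cylinder.
pose a i w : \bar R := (\sum_(k <oo) (\1_(A i k) w)%:E)%E.
have ma i : measurable_fun setT (a i).
  apply: ge0_emeasurable_sum => k; first by move=> w _ _; rewrite lee_fin.
  by move=> _; apply/measurable_EFinP; exact: measurable_indic.
have a0 i w : (0 <= a i w)%E by apply: nneseries_ge0 => k _ _; rewrite lee_fin.
pose b w : \bar R := (\sum_(i <oo) a i w)%E.
(* Infinite outside regular paths, yet with integral 0. *)
pose n w : \bar R := (\sum_(k <oo) (\1_(~` regular x) w)%:E)%E.
have mn : measurable (~` regular x) by apply: measurableC; exact: measurable_regular.
have intn : (\int[Pr_ x]_w n w = 0)%E.
  rewrite integral_indic_series// eseries0// => i _ _; exact: regular_null.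
have b0 w : (0 <= b w)%E by apply: nneseries_ge0.
have n0 w : (0 <= n w)%E by apply: nneseries_ge0 => i _ _; rewrite lee_fin.
have le_rt w : (@return_time R I q M x w <= b w + n w)%E.
  have [reg|nreg] := pselect (regular x w); last first.
    rewrite (_ : n w = +oo%E).
      by rewrite addey ?leey// gt_eqF// (lt_le_trans _ (b0 w)).
    apply/eqyP => r r0; apply: (@le_trans _ _ (Num.truncn r).+1%:R%:E).
      by rewrite lee_fin ltW// truncnS_gt.
    apply: le_trans (nneseries_lim_ge (Num.truncn r).+1 _) => //.
    by rewrite big_mkord sumEFin indicE mem_set// sumr_const card_ord.
  rewrite -[leLHS]adde0; apply: leeD => //; apply: return_time_le => // i av.
  have inA k : (w \in A i k) = (k%:R%:E < hold i w)%E.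
    apply/idP/idP; rewrite inE; first by move=> [_ [_ [_]]].
    case: reg => c0 hpos kw; split; first by move=> j; rewrite leqn0 => /eqP ->.
    split; first by move=> j /av.
    by split=> // j _; exact: hpos.
  have aE : a i w = (\sum_(k <oo) (if (k%:R%:E < hold i w)%E then 1 else 0))%E.
    by apply: eq_eseriesr => k _; rewrite indicE inA; case: ifP.
  split; first by rewrite aE; apply: le_sum_levels; exact: mp_hold_ge0.
  apply: le_trans (nneseries_lim_ge 1 _); last by move=> k _ _; rewrite lee_fin.
  by rewrite big_mkord big_ord_recl big_ord0 adde0 indicE inA (proj2 reg).
apply: (@le_lt_trans _ _ (\int[Pr_ x]_w (b w + n w))%E).
  by apply: le_nonneg_integral => // w; exact: return_time_ge0.
rewrite ge0_integralD//; last 2 first.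
- by apply: ge0_emeasurable_sum.
- apply: ge0_emeasurable_sum => k; first by move=> w _ _; rewrite lee_fin.
  by move=> _; apply/measurable_EFinP; exact: measurable_indic.
rewrite intn adde0 integral_nneseries//.
have [G G0 hG] := cvg_geometric_expR.
have inta i : (\int[Pr_ x]_w a i w <= (G * avoid P nbr x i x)%:E)%E.
  rewrite integral_indic_series//; apply: lime_le; first exact: is_cvg_nneseries.
  apply: nearW => m; rewrite big_mkord.
  apply: (@le_trans _ _ (\sum_(k < m) (expR (- (qmin * k%:R)) * avoid P nbr x i x)%:E)%E).
    apply: lee_sum => k _; rewrite alive_prob// lee_fin.
    by have /andP[] := @survival_taboo x k%:R i x (ler0n _ _).
  by rewrite sumEFin -big_distrl lee_fin ler_wpM2r// avoid_ge0.
apply: (@le_lt_trans _ _ (G * C)%:E); last by rewrite ltry.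
apply: lime_le; first by apply: is_cvg_nneseries => i _ _; exact: integral_ge0.
apply: nearW => m; rewrite big_mkord.
apply: (@le_trans _ _ (\sum_(i < m) (G * avoid P nbr x i x)%:E)%E).
  by apply: lee_sum => i _; exact: inta.
by rewrite sumEFin -big_distrr lee_fin ler_wpM2l.
Qed.

End MinimalProcess.

(** * Splitting one uniform variable into two *)

Section RestrictedLaw.
Context d (T : measurableType d) (R : realType).
Variables (mu : {measure set T -> \bar R}) (D : set T) (f : T -> measurableTypeR R).
Hypotheses (mD : measurable D) (mf : measurable_fun setT f).

(** The two hypotheses are arguments so that the measure structure of this set
function can be inferred from the term. *)
Definition restricted_law (_ : measurable D) (_ : measurable_fun setT f)
  (A : set (measurableTypeR R)) : \bar R := mu (D `&` f @^-1` A).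

Let law := restricted_law mD mf.

Let law0 : law set0 = 0%E.
Proof. by rewrite /law /restricted_law preimage_set0 setI0 measure0. Qed.

Let law_ge0 A : (0 <= law A)%E.
Proof. exact: measure_ge0. Qed.

Let law_additive : semi_sigma_additive law.
Proof.
move=> F mF tF mUF; rewrite /law /restricted_law preimage_bigcup setI_bigcupr.
have mG n : measurable (D `&` f @^-1` F n).
  by apply: measurableI => //; rewrite -[X in measurable X]setTI; exact: mf.
apply: measure_semi_sigma_additive => //; last exact: bigcupT_measurable.
apply/trivIsetP => i j _ _ ij.
apply/seteqP; split => // w [[_ Fi] [_ Fj]].
have : (F i `&` F j) (f w) by split; [exact: Fi|exact: Fj].
by move/trivIsetP : tF => -> .
Qed.

HB.instance Definition _ := isMeasure.Build _ _ _ law law0 law_ge0 law_additive.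

End RestrictedLaw.

Section UniformDigits.
Variable R : realType.
Notation RR := (measurableTypeR R).

(** Lebesgue measure on the unit interval, seen as a probability on the real line. *)
Definition unif : probability RR R := uniform_prob (@ltr01 R).

(** The distribution function of the uniform law. *)
Definition clamp (x : R) : R := Num.max 0 (Num.min x 1).

Lemma unifE (A : set RR) : measurable A ->
  unif A = lebesgue_measure (A `&` `[0, 1[%classic).
Proof.
move=> mA; rewrite /unif /= /uniform_prob integral_uniform_pdf.
rewrite (eq_integral (fun=> 1%E)); last first.
  move=> x; rewrite inE/= in_itv/= /uniform_pdf => -[_ ->].
  by rewrite subr0 invr1.
rewrite integral_cst ?mul1e//; last exact: measurableI.
have m1 : measurable (A `&` [set (1 : R)]) by exact: measurableI.
rewrite (_ : A `&` `[0, 1]%classic = (A `&` `[0, 1[%classic) `|` (A `&` [set 1])); last first.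
  by rewrite -setIUr setUitv1// bnd_simp.
rewrite measureU//; last 2 first.
- exact: measurableI.
- apply/seteqP; split => // x /= [[_]]; rewrite in_itv /= => /andP[_ x1] [_ xE].
  by move: x1; rewrite xE ltxx.
rewrite [X in (_ + X)%E](_ : _ = 0%E) ?adde0//.
apply/eqP; rewrite eq_le measure_ge0 andbT -(lebesgue_measure_set1 1).
by apply: le_measure; rewrite ?inE.
Qed.

Lemma unif_itvo (a b : R) : 0 <= a -> a <= b -> b <= 1 ->
  unif `[a, b[%classic = (b - a)%:E.
Proof.
move=> a0 ab b1; rewrite unifE//.
rewrite (_ : _ `&` _ = `[a, b[%classic).
  rewrite lebesgue_measure_itv /= lte_fin; case: ltP => // ba.
  by rewrite (_ : b = a) ?subrr//; apply/eqP; rewrite eq_le ba ab.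
apply/seteqP; split => x /=; first by move=> [].
rewrite !in_itv /= => /andP[ax xb]; rewrite ax xb; split=> //.
by rewrite (le_trans a0 ax) (lt_le_trans xb b1).
Qed.

Lemma unif_ray (x : R) : unif `]-oo, x[%classic = (clamp x)%:E.
Proof.
rewrite unifE// /clamp; have [x0|x0] := leP x 0.
  rewrite (min_idPl _) ?(le_trans x0)// (max_idPl _)// (_ : _ `&` _ = set0) ?measure0//.
  by apply/seteqP; split => y //=; rewrite !in_itv/= => -[yx /andP[y0 _]]; lra.
have [x1|x1] := leP x 1.
  rewrite (max_idPr _) ?(ltW x0)// (_ : _ `&` _ = `[0, x[%classic).
    by rewrite lebesgue_measure_itv /= lte_fin x0 sube0.
  apply/seteqP; split => y /=; rewrite !in_itv/=.
    by move=> [-> /andP[-> _]].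
  by move=> /andP[y0 yx]; split=> //; rewrite y0 (lt_le_trans yx).
rewrite (max_idPr ler01) (_ : _ `&` _ = `[0, 1[%classic).
  by rewrite lebesgue_measure_itv /= lte_fin ltr01 sube0.
apply/seteqP; split => y /=; rewrite !in_itv/=; first by case.
by move=> /andP[y0 y1]; rewrite y0 y1; split=> //; rewrite (lt_trans y1).
Qed.

(** The open left rays generate the Borel sets and are stable under intersection. *)
Lemma restricted_law_unif (D : set RR) (f : RR -> RR) (c : R) :
  measurable D -> measurable_fun setT f -> 0 <= c ->
  (forall x, unif (D `&` f @^-1` `]-oo, x[%classic) = (c * clamp x)%:E) ->
  forall A, measurable A -> unif (D `&` f @^-1` A) = (c%:E * unif A)%E.
Proof.
move=> mD mf c0 rays A mA.
pose m1 := restricted_law unif mD mf.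
pose m2 := mscale (NngNum c0) unif.
apply: (@measure_unique _ R RR (@RGenInftyO.G R) (fun n => `]-oo, n%:R[%classic) _ _ _ _ m1 m2) => //.
- exact: RGenInftyO.measurableE.
- move=> _ _ [x ->] [y ->]; exists (Num.min x y).
  by apply/seteqP; split => z /=; rewrite !in_itv/= lt_min => /andP.
- by move=> n; exists n%:R.
- apply/seteqP; split => // x _; exists (Num.truncn `|x|).+1 => //=.
  by rewrite in_itv/= (le_lt_trans (ler_norm _))// truncnS_gt.
- move=> _ [x ->]; transitivity ((c * clamp x)%:E); first exact: rays.
  by rewrite EFinM -unif_ray.
- move=> n; apply: (@le_lt_trans _ _ (c * clamp n%:R)%:E); last by rewrite ltry.
  by rewrite le_eqVlt -rays eqxx.
Qed.

Definition bit (w : R) : bool := 2^-1 <= w.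

(** The doubling map modulo 1 on the unit interval, which forgets the first binary digit
[bit w]. *)
Definition shift (w : R) : R := w *+ 2 - (bit w)%:R.

Lemma measurable_bit (b : bool) : measurable [set w : RR | bit w = b].
Proof.
have m1 : measurable [set w : RR | bit w].
  rewrite (_ : [set _ | _] = `[2^-1, +oo[%classic)//.
  by apply/seteqP; split => w /=; rewrite in_itv/= andbT.
case: b => //; rewrite (_ : [set _ | _] = ~` [set w : RR | bit w]).
  exact: measurableC.
by apply/seteqP; split => w /=; [move=> ->|move/negP/negbTE].
Qed.

Lemma measurable_bitr : measurable_fun setT (fun w : RR => (bit w)%:R : RR).
Proof.
rewrite (_ : (fun _ => _) = \1_[set w : RR | bit w]).
  apply: measurable_indic; exact: (measurable_bit true).
by apply/funext => w; rewrite indicE; congr (_%:R); case: (boolP (bit w)) => h;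
  [rewrite mem_set|rewrite memNset//; apply/negP].
Qed.

Lemma measurable_shift : measurable_fun setT (shift : RR -> RR).
Proof.
apply: measurable_funB; last exact: measurable_bitr.
by apply: measurable_funD; exact: measurable_id.
Qed.

Lemma clamp_eq0 x : x <= 0 -> clamp x = 0.
Proof. by move=> x0; rewrite /clamp (min_idPl _) ?(le_trans x0)// (max_idPl _). Qed.

Lemma clamp_eq1 x : 1 <= x -> clamp x = 1.
Proof. by move=> x1; rewrite /clamp (min_idPr _)// (max_idPr _). Qed.

Lemma clamp_id x : 0 <= x <= 1 -> clamp x = x.
Proof. by move=> /andP[x0 x1]; rewrite /clamp (min_idPl _)// (max_idPr _). Qed.

Lemma clamp_ge0 x : 0 <= clamp x.
Proof. by rewrite /clamp le_max lexx. Qed.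

Lemma clamp_le1 x : clamp x <= 1.
Proof. by rewrite /clamp ge_max ler01 /= ge_min lexx orbT. Qed.

Lemma clamp_double x : clamp x = 2^-1 * (clamp (x *+ 2) + clamp (x *+ 2 - 1)).
Proof.
have [x0|x0] := leP x 0.
  by rewrite !clamp_eq0 ?addr0 ?mulr0//; lra.
have [x1|x1] := leP 1 x.
  by rewrite !clamp_eq1; lra.
have [xh|xh] := leP x 2^-1.
  rewrite (@clamp_eq0 (x *+ 2 - 1)) ?clamp_id; lra.
rewrite (@clamp_eq1 (x *+ 2)) ?clamp_id; lra.
Qed.

(** The first digit of a uniform number is a fair coin, and what is left is uniform and
independent of it. *)
Lemma unif_shift (b : bool) (A : set RR) : measurable A ->
  unif ([set w | bit w = b] `&` shift @^-1` A) = (2^-1%:E * unif A)%E.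
Proof.
apply: restricted_law_unif => [|||x].
- exact: measurable_bit.
- exact: measurable_shift.
- by rewrite invr_ge0.
have h2 : 2^-1 = 1 / 2 :> R by rewrite mul1r.
have bw (w : R) : (bit w = b) <-> (if b then 1 <= w *+ 2 else w *+ 2 < 1).
  rewrite /bit h2; case: b; split; [lra|lra| |].
    by move/negbT; rewrite -ltNge; lra.
  by move=> h; apply/negbTE; rewrite -ltNge; lra.
have cx : [\/ x <= 0 /\ clamp x = 0, 0 <= x <= 1 /\ clamp x = x | 1 <= x /\ clamp x = 1].
  have [x0|x0] := leP x 0; first by constructor 1; rewrite clamp_eq0.
  have [x1|x1] := leP x 1; last by constructor 3; rewrite clamp_eq1 ltW.
  have x01 : 0 <= x <= 1 by rewrite (ltW x0) x1.
  by constructor 2; split; [rewrite (ltW x0)|exact: clamp_id].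
have mS : measurable ([set w : RR | bit w = b] `&` shift @^-1` `]-oo, x[%classic).
  apply: measurableI; first exact: measurable_bit.
  by rewrite -[X in measurable X]setTI; exact: measurable_shift.
rewrite unifE//.
rewrite (_ : _ `&` _ = `[if b then 2^-1 else 0, (if b then 2^-1 else 0) + 2^-1 * clamp x[%classic); last first.
  apply/seteqP; split => w /=; rewrite !in_itv /= /shift.
    move=> [[wE wx] /andP[w0 w1]]; have wb := (bw w).1 wE; rewrite wE in wx.
    rewrite h2; case: b wb wx {mS bw wE} => /= wb wx.
    - by case: cx => -[? ->]; apply/andP; split; lra.
    - by case: cx => -[? ->]; apply/andP; split; lra.
  move=> /andP[lw wl].
  have wb : bit w = b by apply/bw; move: lw wl; rewrite h2; case: b {mS bw}; case: cx => -[? ->]; lra.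
  rewrite wb; split; first split => //; move: lw wl; rewrite h2; case: b {mS bw wb} => /= lw wl.
  - by case: cx wl => -[? ->]; lra.
  - by case: cx wl => -[? ->]; lra.
  - by case: cx wl => -[? ->] ?; apply/andP; split; lra.
  - by case: cx wl => -[? ->] ?; apply/andP; split; lra.
rewrite lebesgue_measure_itv /= lte_fin ltrDl.
have [c0|c0] := ltP 0 (2^-1 * clamp x); first by rewrite -EFinB addrAC subrr add0r.
congr (_%:E); have := clamp_ge0 x; lra.
Qed.

(** The last step of a contraction argument with ratio 1/2. *)
Lemma eq0_le_half_pow (x : R) : (forall n, `|x| <= 2^-1 ^+ n) -> x = 0.
Proof.
move=> h; apply/eqP; rewrite -normr_eq0 eq_le normr_ge0 andbT.
apply/ler_addgt0Pr => e e0; rewrite add0r.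
pose n := (Num.truncn e^-1).+1; apply: le_trans (h n) _.
have en : e^-1 < n%:R by exact: truncnS_gt.
rewrite exprVn -[e]invrK lef_pV2 ?posrE ?exprn_gt0 ?invr_gt0//.
rewrite (le_trans (ltW en))// -natrX ler_nat ltnW//.
exact: ltn_expl.
Qed.

Fixpoint even_approx n (w : R) : R :=
  if n is n'.+1 then 2^-1 * ((bit w)%:R + even_approx n' (shift (shift w)))
  else 0.

Lemma even_approx_itv n w : 0 <= even_approx n w <= 1.
Proof.
elim: n w => [|n IH] w /=; first by rewrite lexx ler01.
have /andP[] := IH (shift (shift w)); set u := even_approx _ _ => u0 u1.
have b0 : 0 <= (bit w)%:R :> R by rewrite ler0n.
have b1 : (bit w)%:R <= 1 :> R by case: bit.
lra.
Qed.

Lemma even_approxS n w : even_approx n w <= even_approx n.+1 w.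
Proof.
elim: n w => [|n IH] w; first by have /andP[] := even_approx_itv 1 w.
by rewrite /= ler_pM2l ?invr_gt0// lerD2l; exact: IH.
Qed.

(** The number whose binary digits are those of w of even rank, the first one having
rank 0. *)
Definition even_part (w : R) : R := limn (even_approx^~ w).

Definition odd_part (w : R) : R := even_part (shift w).

Lemma cvg_even_approx w : even_approx^~ w @ \oo --> even_part w.
Proof.
apply: nondecreasing_is_cvgn.
  by apply/nondecreasing_seqP => n; exact: even_approxS.
by exists 1 => _ [n _ <-]; have /andP[] := even_approx_itv n w.
Qed.

(** The first digit followed by the odd digits of the remainder. Together with the
definition of [odd_part], this recursion determines the joint law of both parts. *)
Lemma even_partE w : even_part w = 2^-1 * ((bit w)%:R + odd_part (shift w)).
Proof.
apply: cvg_lim => //; rewrite -cvg_shiftS /=.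
apply: cvgMr; apply: cvgD; first exact: cvg_cst.
exact: cvg_even_approx.
Qed.

Lemma even_part_itv w : 0 <= even_part w <= 1.
Proof.
apply/andP; split.
  apply: limr_ge; first exact: cvgP (@cvg_even_approx w).
  by apply: nearW => n; have /andP[] := even_approx_itv n w.
apply: limr_le; first exact: cvgP (@cvg_even_approx w).
by apply: nearW => n; have /andP[] := even_approx_itv n w.
Qed.

Lemma measurable_even_part : measurable_fun setT (even_part : RR -> RR).
Proof.
have ma n : measurable_fun setT (even_approx n : RR -> RR).
  elim: n => [|n IH] /=; first exact: measurable_cst.
  apply: measurable_funM; first exact: measurable_cst.
  apply: measurable_funD; first exact: measurable_bitr.
  apply: (measurableT_comp IH).
  by apply: measurableT_comp; exact: measurable_shift.
apply: (@measurable_fun_cvg _ _ _ _ even_approx) => //.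
by move=> w _; exact: cvg_even_approx.
Qed.

Lemma measurable_odd_part : measurable_fun setT (odd_part : RR -> RR).
Proof. exact: measurableT_comp measurable_even_part measurable_shift. Qed.

Definition parts_below (a b : R) : set RR :=
  [set w | even_part w < a /\ odd_part w < b].

Lemma measurable_parts_below a b : measurable (parts_below a b).
Proof.
have mray (x : R) : measurable (`]-oo, x[%classic : set RR) by [].
rewrite (_ : parts_below a b =
  even_part @^-1` `]-oo, a[%classic `&` odd_part @^-1` `]-oo, b[%classic).
  apply: measurableI; rewrite -[X in measurable X]setTI.
    exact: measurable_even_part.
  exact: measurable_odd_part.
by apply/seteqP; split => w /=; rewrite !in_itv.
Qed.

Definition joint_cdf (a b : R) : R := fine (unif (parts_below a b)).

Lemma joint_cdfE a b : unif (parts_below a b) = (joint_cdf a b)%:E.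
Proof. by rewrite /joint_cdf fineK// fin_num_measure//; exact: measurable_parts_below. Qed.

(** Conditioning on the first digit exchanges the roles of the two parts. *)
Lemma joint_cdf_rec a b :
  joint_cdf a b = 2^-1 * (joint_cdf b (a *+ 2) + joint_cdf b (a *+ 2 - 1)).
Proof.
apply: EFin_inj; rewrite -joint_cdfE EFinM EFinD -!joint_cdfE.
have mp := measurable_parts_below.
rewrite muleDr ?ge0_adde_def ?inE ?measure_ge0//.
rewrite -(unif_shift false (mp _ _)) -(unif_shift true (mp _ _)).
have mb c (A : set RR) : measurable A -> measurable ([set w | bit w = c] `&` shift @^-1` A : set RR).
  move=> mA; apply: measurableI; first exact: measurable_bit.
  by rewrite -[X in measurable X]setTI; exact: measurable_shift.
rewrite -measureU; last first.
  by apply/seteqP; split => // w [[/= -> _] [/=]].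
  by apply: mb; exact: mp.
  by apply: mb; exact: mp.
congr (unif _).
apply/seteqP; split => w; rewrite /parts_below /= (even_partE w) -/(odd_part w).
  case: bit => /= -[h1 h2]; [right|left]; split=> //; split=> //; lra.
by case: bit => /= -[] []// _ [? ?]; split=> //; lra.
Qed.

Lemma joint_cdf_le0 a b : b <= 0 -> joint_cdf a b = 0.
Proof.
move=> b0; rewrite /joint_cdf (_ : parts_below a b = set0) ?measure0//.
apply/seteqP; split => // w [_ ob].
by have /andP[] := even_part_itv (shift w); rewrite -/(odd_part w); lra.
Qed.

Lemma joint_cdf_gt1 a b : 1 < b -> joint_cdf a b = joint_cdf a 2.
Proof.
move=> b1; rewrite /joint_cdf; congr (fine (unif _)).
apply/seteqP; split => w [ea ob]; split=> //;
by have /andP[] := even_part_itv (shift w); rewrite -/(odd_part w); lra.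
Qed.

(** The marginal distribution function G satisfies G x = (G (2x) + G (2x - 1)) / 2, as
does [clamp]; on each half of the line one of the two terms agrees with that of
[clamp], so the distance between both is halved at each iteration. *)
Lemma joint_cdf_marginal a : joint_cdf a 2 = clamp a.
Proof.
pose G x := joint_cdf x 2.
have G2 x : joint_cdf 2 x = G x.
  rewrite joint_cdf_rec (@joint_cdf_gt1 x (2 *+ 2)); last by lra.
  by rewrite (@joint_cdf_gt1 x (2 *+ 2 - 1)) /G; lra.
have Grec x : G x = 2^-1 * (G (x *+ 2) + G (x *+ 2 - 1)).
  by rewrite {1}/G joint_cdf_rec !G2.
have G0 x : x <= 0 -> G x = 0 by move=> x0; rewrite -G2 joint_cdf_le0.
have G1 x : 1 < x -> G x = 1.
  move=> x1; rewrite /G /joint_cdf (_ : parts_below x 2 = setT).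
    by rewrite probability_setT.
  apply/seteqP; split => // w _; split.
    by have /andP[] := even_part_itv w; lra.
  by have /andP[] := even_part_itv (shift w); rewrite -/(odd_part w); lra.
apply/eqP; rewrite -subr_eq0; apply/eqP/eq0_le_half_pow => n; rewrite -/(G a).
elim: n a => [|n IH] a.
  have : 0 <= G a <= 1.
    rewrite /G -!lee_fin -joint_cdfE measure_ge0 probability_le1//.
    exact: measurable_parts_below.
  move=> /andP[? ?]; rewrite expr0 ler_norml.
  by have := clamp_ge0 a; have := clamp_le1 a; lra.
rewrite exprS Grec clamp_double -mulrBr normrM ger0_norm ?invr_ge0//.
rewrite ler_pM2l ?invr_gt0//.
have [ah|ah] := leP a 2^-1.
  by rewrite (@G0 (a *+ 2 - 1)) ?(@clamp_eq0 (a *+ 2 - 1)) ?addr0//; lra.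
rewrite (@G1 (a *+ 2)) ?(@clamp_eq1 (a *+ 2)); [|lra|lra].
by rewrite opprD addrACA subrr add0r.
Qed.

(** The same contraction as for the marginals, whose exact value settles the term whose
argument exceeds 1. *)
Lemma joint_cdf_clamp a b : joint_cdf a b = clamp a * clamp b.
Proof.
apply/eqP; rewrite -subr_eq0; apply/eqP/eq0_le_half_pow => n.
elim: n a b => [|n IH] a b.
  have : 0 <= joint_cdf a b <= 1.
    rewrite -!lee_fin -joint_cdfE measure_ge0 probability_le1//.
    exact: measurable_parts_below.
  move=> /andP[? ?]; rewrite expr0 ler_norml.
  have := mulr_ge0 (clamp_ge0 a) (clamp_ge0 b).
  have := mulr_ile1 (clamp_ge0 a) (clamp_ge0 b) (clamp_le1 a) (clamp_le1 b).
  by lra.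
rewrite exprS joint_cdf_rec clamp_double -mulrA -mulrBr normrM ger0_norm ?invr_ge0//.
rewrite ler_pM2l ?invr_gt0//.
have [ah|ah] := leP a 2^-1.
  rewrite (@joint_cdf_le0 _ (a *+ 2 - 1)); last by lra.
  rewrite (@clamp_eq0 (a *+ 2 - 1)); last by lra.
  by rewrite !addr0 mulrC.
rewrite joint_cdf_gt1; last by lra.
rewrite joint_cdf_marginal (@clamp_eq1 (a *+ 2)); last by lra.
by rewrite mulrDl mul1r opprD addrACA subrr add0r mulrC.
Qed.

(** Even and odd digits of a uniform number are independent uniform numbers. The rays
are treated by [joint_cdf_clamp], then extended to Borel sets in one factor at a time. *)
Lemma unif_split (A B : set RR) : measurable A -> measurable B ->
  unif (even_part @^-1` A `&` odd_part @^-1` B) = (unif A * unif B)%E.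
Proof.
move=> mA mB; rewrite setIC.
have mo (C : set RR) : measurable C -> measurable (odd_part @^-1` C : set RR).
  by move=> mC; rewrite -[X in measurable X]setTI; exact: measurable_odd_part.
have me (C : set RR) : measurable C -> measurable (even_part @^-1` C : set RR).
  by move=> mC; rewrite -[X in measurable X]setTI; exact: measurable_even_part.
have fB : unif B = (fine (unif B))%:E by rewrite fineK// fin_num_measure.
rewrite muleC fB; apply: restricted_law_unif => //.
- exact: mo.
- exact: measurable_even_part.
- by rewrite fine_ge0.
move=> x; rewrite setIC mulrC EFinM -fB.
apply: (restricted_law_unif _ _ (clamp_ge0 x)) => //.
- exact: me.
- exact: measurable_odd_part.
by move=> y; rewrite -joint_cdf_clamp -joint_cdfE; congr (unif _).
Qed.

End UniformDigits.

(** * Existence of the minimal process *)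

Section Realization.
Variables (R : realType) (I : countType) (q : I -> I -> R) (nbr : I -> seq I).
Notation P := (jump_prob q).
Notation RR := (measurableTypeR R).
Notation unif := (unif R).
Hypothesis P_ge0 : forall x y, 0 <= P x y.
Hypothesis P_sum1 : forall x, \sum_(y <- nbr x) P x y = 1.
Hypothesis nbr_uniq : forall x, uniq (nbr x).
Hypothesis P_nbr : forall x y, y \notin nbr x -> P x y = 0.
Hypothesis rate_gt0 : forall x, 0 < exit_rate q x.

(** Inversion sampling: successive intervals of lengths P x y, y in s, start at acc. The
final default x is only reached outside the unit interval when the lengths sum to
1 - acc. *)
Fixpoint sample (x : I) (s : seq I) (acc u : R) : I :=
  if s is y :: s' then
    if u < acc + P x y then y else sample x s' (acc + P x y) u
  else x.

Lemma measurable_sample x s acc y : measurable [set u : RR | sample x s acc u = y].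
Proof.
elim: s acc => [|z s IH] acc /=.
  have [->|xy] := eqVneq x y.
    by rewrite (_ : [set _ | _] = setT)//; apply/seteqP; split.
  by rewrite (_ : [set _ | _] = set0)//; apply/seteqP; split => // u /= /eqP; rewrite (negbTE xy).
rewrite (_ : [set _ | _] = (`]-oo, acc + P x z[%classic `&` (if z == y then setT else set0))
   `|` (`[acc + P x z, +oo[%classic `&` [set u | sample x s (acc + P x z) u = y])).
  by apply: measurableU; apply: measurableI => //; case: ifP.
apply/seteqP; split => u /=; rewrite !in_itv/= andbT leNgt.
  by case: ltP => h; [move=> ->; rewrite eqxx; left|right].
by case: ltP => h [] [] //; case: eqP.
Qed.

(** The interval of the head of s has length P x z, and the tail is sampled further right. *)
Lemma unif_sample x s acc y : 0 <= acc -> acc + \sum_(z <- s) P x z = 1 ->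
  unif (`[acc, +oo[%classic `&` [set u | sample x s acc u = y]) =
  (\sum_(z <- s) (z == y)%:R * P x z)%:E.
Proof.
elim: s acc => [|z s IH] acc acc0 /=.
  rewrite !big_nil addr0 => acc1; rewrite unifE.
    rewrite (_ : _ `&` _ = set0) ?measure0//; apply/seteqP; split => // u /=.
    by rewrite !in_itv/= acc1 => -[[]]; lra.
  by apply: measurableI => //; exact: (measurable_sample x [::] acc y).
rewrite !big_cons addrA => acc1.
have Pz := P_ge0 x z.
have mS : measurable (`[acc + P x z, +oo[%classic `&`
    [set u : RR | sample x s (acc + P x z) u = y] : set RR).
  by apply: measurableI => //; exact: measurable_sample.
have s0 : 0 <= \sum_(z <- s) P x z by exact: sumr_ge0.
rewrite (_ : _ `&` _ = (`[acc, acc + P x z[%classic `&` (if z == y then setT else set0))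
   `|` (`[acc + P x z, +oo[%classic `&` [set u | sample x s (acc + P x z) u = y])); last first.
  apply/seteqP; split => u /=; rewrite !in_itv/= !andbT.
    move=> [au]; case: ltP => h.
      by move=> ->; rewrite eqxx au; left.
    by right.
  move=> [[/andP[-> ->]]|[h1 h2]]; first by case: eqP.
  by rewrite (le_trans _ h1) ?lerDl// ltNge h1.
rewrite measureU//; last 2 first.
- by apply: measurableI => //; case: ifP.
- apply/seteqP; split => // u /=; rewrite !in_itv/= => -[[/andP[_ h] _] [h' _]].
  by move: h'; rewrite andbT leNgt h.
rewrite EFinD; congr (_ + _)%E; last by apply: IH => //; rewrite addr_ge0.
case: eqP => _; last by rewrite setI0 measure0 mul0r.
rewrite setIT mul1r; apply: (etrans (unif_itvo _ _ _)); rewrite ?lerDl//.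
  by lra.
by rewrite addrAC subrr add0r.
Qed.

Definition next_state x u := sample x (nbr x) 0 u.

Lemma unif_next_state x y : unif [set u | next_state x u = y] = (P x y)%:E.
Proof.
have -> : P x y = \sum_(z <- nbr x) (z == y)%:R * P x z.
  have [yn|yn] := boolP (y \in nbr x).
    rewrite (bigD1_seq y)//= eqxx mul1r big1 ?addr0// => z /negbTE ->.
    by rewrite mul0r.
  rewrite P_nbr// big_seq big1// => z zn.
  by case: eqP => [zy|_]; rewrite ?mul0r//; move: yn; rewrite -zy zn.
rewrite -(@unif_sample x (nbr x) 0 y)// ?add0r// unifE; last exact: measurable_sample.
rewrite unifE; last by apply: measurableI => //; exact: measurable_sample.
congr (lebesgue_measure _); apply/seteqP; split => u /=; rewrite !in_itv/=.
  by move=> [h /andP[u0 u1]]; rewrite u0 u1.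
by move=> [[_ h] h'].
Qed.

(** Inversion sampling of the exponential law with parameter [exit_rate q x]. *)
Definition exp_sample x (u : R) : R := - ln u / exit_rate q x.

Lemma measurable_exp_sample x : measurable_fun setT (exp_sample x : RR -> RR).
Proof.
apply: measurable_funM; last exact: measurable_cst.
by apply: measurable_funN; exact: measurable_ln.
Qed.

Lemma measurable_exp_sample_gt x (t : R) :
  measurable [set u : RR | t < exp_sample x u].
Proof.
rewrite (_ : [set _ | _] = exp_sample x @^-1` `]t, +oo[%classic).
  by rewrite -[X in measurable X]setTI; apply: measurable_exp_sample.
by apply/seteqP; split => u /=; rewrite in_itv/= andbT.
Qed.

Lemma unif_exp_sample x (t : R) : 0 <= t ->
  unif [set u | t < exp_sample x u] = (expR (- (exit_rate q x * t)))%:E.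
Proof.
move=> t0; have r0 := rate_gt0 x.
have m1 := measurable_exp_sample_gt x t.
set b := expR _.
have b0 : 0 < b by exact: expR_gt0.
have b1 : b <= 1 by rewrite -expR0 ler_expR oppr_le0 mulr_ge0// ltW.
rewrite unifE// (_ : _ `&` _ = `]0, b[%classic).
  by rewrite lebesgue_measure_itv /= lte_fin b0 sube0.
apply/seteqP; split => u /=; rewrite !in_itv/=; last first.
  move=> /andP[u0 ub]; split; last by rewrite (ltW u0) (lt_le_trans ub).
  rewrite /exp_sample ltr_pdivlMr// ltrNr -ltr_expR lnK ?posrE//.
  by rewrite mulrC.
rewrite /exp_sample ltr_pdivlMr// ltrNr => -[h /andP[u0 u1]].
have u_gt0 : 0 < u.
  rewrite lt_neqAle u0 andbT eq_sym; apply/negP => /eqP u00; move: h.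
  by rewrite u00 ln0// ltNge oppr_le0 mulr_ge0// ltW.
by rewrite u_gt0 -[u]lnK ?posrE// ltr_expR mulrC.
Qed.

(** One step of the process consumes three independent uniform numbers obtained by
splitting w twice: one for the holding time, one for the next state, and [rest w], from
which the future is built in the same way. *)
Definition hold_time x (w : R) : R := exp_sample x (even_part w).

Definition jump x (w : R) : I := next_state x (even_part (odd_part w)).

Definition rest (w : R) : R := odd_part (odd_part w).

Fixpoint path_state n x w : I :=
  if n is n'.+1 then path_state n' (jump x w) (rest w) else x.

Fixpoint path_hold n x w : R :=
  if n is n'.+1 then path_hold n' (jump x w) (rest w) else hold_time x w.

Lemma measurable_rest : measurable_fun setT (rest : RR -> RR).
Proof. exact: measurableT_comp (@measurable_odd_part R) (@measurable_odd_part R). Qed.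

Lemma measurable_jump x y : measurable [set w : RR | jump x w = y].
Proof.
have m : measurable_fun setT (fun w : RR => even_part (odd_part w) : RR).
  exact: measurableT_comp (@measurable_even_part R) (@measurable_odd_part R).
rewrite (_ : [set _ | _] =
  (fun w => even_part (odd_part w)) @^-1` [set u : RR | next_state x u = y])//.
by rewrite -[X in measurable X]setTI; apply: m => //; exact: measurable_sample.
Qed.

Lemma measurable_after_jump (A : I -> set RR) x : (forall z, measurable (A z)) ->
  measurable [set w : RR | A (jump x w) (rest w)].
Proof.
move=> mA; pose F k := if unpickle k is Some z then
   [set w : RR | jump x w = z] `&` rest @^-1` A z else set0.
rewrite (_ : [set w | _] = \bigcup_k F k).
  apply: bigcupT_measurable => k; rewrite /F; case: unpickle => // z.
  apply: measurableI; first exact: measurable_jump.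
  by rewrite -[X in measurable X]setTI; apply: measurable_rest => //; exact: mA.
apply/seteqP; split => w /= => [Aw|[k _]].
  by exists (pickle (jump x w)) => //; rewrite /F pickleK.
by rewrite /F; case: unpickle => // z [/= <-].
Qed.

Lemma measurable_path_state n x y : measurable [set w : RR | path_state n x w = y].
Proof.
elim: n x => [|n IH] x /=; last first.
  exact: (@measurable_after_jump (fun z => [set w : RR | path_state n z w = y])).
have [->|xy] := eqVneq x y.
  by rewrite (_ : [set _ | _] = setT)//; apply/seteqP; split.
by rewrite (_ : [set _ | _] = set0)//; apply/seteqP; split => // u /= /eqP; rewrite (negbTE xy).
Qed.

Lemma measurable_path_hold n x : measurable_fun setT (path_hold n x : RR -> RR).
Proof.
move=> _ B mB; rewrite setTI; elim: n x => [|n IH] x /=; last first.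
  exact: (@measurable_after_jump (fun z => path_hold n z @^-1` B)).
rewrite -[X in measurable X]setTI.
exact: (measurableT_comp (measurable_exp_sample x) (@measurable_even_part R)).
Qed.

(** By induction on n: the event is a product event for the three parts of w, the third
one being the same event for the path that starts at the next state. *)
Lemma path_law x n (y : nat -> I) (t : nat -> R) : (forall i, 0 <= t i) ->
  unif [set w | forall i, (i <= n)%N ->
     path_state i x w = y i /\ t i < path_hold i x w] =
  ((x == y 0%N)%:R * (\prod_(i < n) P (y i) (y i.+1))
   * (\prod_(i < n.+1) expR (- (exit_rate q (y i) * t i))))%:E.
Proof.
move=> t0; have [xy|xy] := eqVneq x (y 0%N); last first.
  rewrite (_ : [set _ | _] = set0) ?measure0 ?mul0r//.
  by apply/seteqP; split => // w /= /(_ 0%N (leq0n _)) [] /eqP; rewrite (negbTE xy).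
elim: n x y t t0 xy => [|n IH] x y t t0 xy.
  rewrite mul1r big_ord0 mul1r big_ord_recl big_ord0 mulr1 /=.
  rewrite -xy -unif_exp_sample//.
  have m1 := measurable_exp_sample_gt x (t 0%N).
  rewrite -[RHS]mule1 -(probability_setT unif) -unif_split// preimage_setT setIT.
  congr (unif _); apply/seteqP; split => w /=.
    by move=> /(_ 0%N isT)[].
  by move=> h i; rewrite leqn0 => /eqP ->.
have m1 := measurable_exp_sample_gt x (t 0%N).
pose E := [set w : RR | forall i, (i <= n)%N ->
     path_state i (y 1%N) w = y i.+1 /\ t i.+1 < path_hold i (y 1%N) w].
have mE : measurable E.
  rewrite (_ : E = \bigcap_i [set w | (i <= n)%N ->
     path_state i (y 1%N) w = y i.+1 /\ t i.+1 < path_hold i (y 1%N) w]); last first.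
    by apply/seteqP; split => w /= h i; [move=> _; exact: h|exact: h].
  apply: bigcapT_measurable => i; case: (i <= n)%N; last first.
    by rewrite (_ : [set _ | _] = setT)//; apply/seteqP; split.
  rewrite (_ : [set _ | _] = [set w | path_state i (y 1%N) w = y i.+1] `&`
     path_hold i (y 1%N) @^-1` `]t i.+1, +oo[%classic).
    apply: measurableI; first exact: measurable_path_state.
    by rewrite -[X in measurable X]setTI; apply: measurable_path_hold.
  apply/seteqP; split => w /=; rewrite in_itv/= andbT; first exact.
  by move=> h _.
have mN : measurable [set u : RR | next_state x u = y 1%N] by exact: measurable_sample.
rewrite (_ : [set _ | _] = @even_part R @^-1` [set u | t 0%N < exp_sample x u] `&`
   @odd_part R @^-1` (@even_part R @^-1` [set u | next_state x u = y 1%N] `&` @odd_part R @^-1` E));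
  last first.
  apply/seteqP; split => w /=.
    move=> h; have [_ h0] := h 0%N isT; have [h1 _] := h 1%N isT.
    split=> //; split=> // i im; have := h i.+1 im; rewrite /= -h1.
    by rewrite /= in h1 *.
  move=> [h0 [h1 h2]] [|i] //= im.
  by rewrite /jump h1; exact: h2.
have mo (C : set RR) : measurable C -> measurable (@odd_part R @^-1` C : set RR).
  by move=> mC; rewrite -[X in measurable X]setTI; apply: measurable_odd_part.
have me (C : set RR) : measurable C -> measurable (@even_part R @^-1` C : set RR).
  by move=> mC; rewrite -[X in measurable X]setTI; apply: measurable_even_part.
rewrite unif_split//; last by apply: measurableI; [exact: me|exact: mo].
rewrite unif_split// unif_exp_sample// unif_next_state.
rewrite [X in (_ * (_ * X))%E](_ : _ = (true%:R * (\prod_(i < n) P (y i.+1) (y i.+2))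
   * (\prod_(i < n.+1) expR (- (exit_rate q (y i.+1) * t i.+1))))%:E); last first.
  exact: (IH (y 1%N) (y \o S) (t \o S) (fun i => t0 i.+1) erefl).
rewrite -!EFinM [in RHS]big_ord_recl /= [X in _ = (_ * X)%:E]big_ord_recl /=.
by rewrite -xy !mul1r; congr (_%:E); ring.
Qed.

(** The initial state is stored in the first component as a natural number, for which a
measurable structure is at hand; the second one is uniform. *)
Definition start_at (x : I) (w : RR) : (nat * RR)%type := (pickle x, w).

Lemma measurable_start_at x : measurable_fun setT (start_at x).
Proof. by apply: measurable_fun_pair; [exact: measurable_cst|exact: measurable_id]. Qed.

Definition chain_law (x : I) : probability (nat * RR)%type R :=
  distribution unif (mfun_Sub (mem_set (measurable_start_at x))).

Lemma chain_lawE x A : chain_law x A = unif (start_at x @^-1` A).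
Proof. by []. Qed.

Lemma measurable_nat_slices (A : set (nat * RR)) :
  (forall k, measurable [set w : RR | A (k, w)]) -> measurable A.
Proof.
move=> mA; rewrite (_ : A = \bigcup_k ([set k] `*` [set w | A (k, w)])).
  by apply: bigcup_measurable => k _; apply: measurableX.
apply/seteqP; split => [[k w] /= Akw|[k w] [k' _ [/= ->]]//].
by exists k.
Qed.

(** The default x0 is taken at numbers that encode no state, a null event for every law
in the family. *)
Definition start (x0 : I) (w : nat * R) : I :=
  if unpickle w.1 is Some x then x else x0.

Theorem minimal_process_exists (x0 : I) : inhabited (minimal_process q).
Proof.
constructor.
apply: (@MinimalProcess R I q _ (nat * RR)%type chain_law
  (fun n w => path_state n (start x0 w) w.2)
  (fun n w => (Num.max 0 (path_hold n (start x0 w) w.2))%:E)).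
- move=> n y; apply: measurable_nat_slices => k /=.
  exact: (measurable_path_state n (start x0 (k, 0)) y).
- move=> n; apply/measurable_EFinP; apply: measurable_maxr; first exact: measurable_cst.
  move=> _ B mB; rewrite setTI; apply: measurable_nat_slices => k /=.
  rewrite -[X in measurable X]setTI.
  exact: (measurable_path_hold n (start x0 (k, 0)) measurableT mB).
- by move=> n w; rewrite lee_fin le_max lexx.
move=> x n y t t0; rewrite chain_lawE -path_law//; congr (unif _).
have sE w : start x0 (start_at x w) = x by rewrite /start /= pickleK.
apply/seteqP; split => w /= h i im; have := h i im; rewrite sE lte_fin lt_max.
  by move=> [-> /orP[]]//; rewrite ltNge t0.
by move=> [-> ->]; rewrite orbT.
Qed.

End Realization.

(** * The tandem system and its generator *)

Section Tandem.
Variables (R : realType) (lam : nat -> R) (mu1 mu2 : R).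
Hypothesis lam_ge0 : forall n, 0 <= lam n.
Hypothesis lam_le1 : forall n, lam n <= 1.
Hypothesis lam0_gt0 : 0 < lam 0.
Hypothesis mu1_gt0 : 0 < mu1.
Hypothesis mu2_gt0 : 0 < mu2.

Notation state := (nat * nat)%type.
Notation q := (system_rate lam mu1 mu2).
Notation P := (jump_prob q).

(** Arrival, transfer from the first queue to the second one, departure. This list can
contain an arrival whose rate is 0. *)
Definition targets (x : state) : seq state :=
  (x.1.+1, x.2) :: (if (0 < x.1)%N then [:: (x.1.-1, x.2.+1)] else [::]) ++
                   (if (0 < x.2)%N then [:: (x.1, x.2.-1)] else [::]).

Definition total_rate (x : state) : R :=
  lam x.2 + (0 < x.1)%:R * mu1 + (0 < x.2)%:R * mu2.

Lemma targets_uniq x : uniq (targets x).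
Proof.
by case: x => -[|a] [|b]; rewrite /targets //= !inE !xpair_eqE; lia.
Qed.

Lemma targets_neq x y : y \in targets x -> y != x.
Proof.
case: x y => [a b] [c d]; rewrite /targets inE mem_cat /=.
by case: a => [|a]; case: b => [|b]; rewrite /= ?inE !xpair_eqE; lia.
Qed.

Lemma system_rate_targets x y : y \notin targets x -> q x y = 0.
Proof.
rewrite /targets /system_rate inE mem_cat !negb_or => /and3P[/negbTE -> h1 h2].
move: h1 h2; case: (0 < x.1)%N; case: (0 < x.2)%N; rewrite ?inE //=;
by do 2?[first [move=> /negbTE -> | move=> _]].
Qed.

Lemma sum_targets (f : state -> R) x :
  \sum_(y <- targets x) q x y * f y = lam x.2 * f (x.1.+1, x.2) +
    (0 < x.1)%:R * mu1 * f (x.1.-1, x.2.+1) + (0 < x.2)%:R * mu2 * f (x.1, x.2.-1).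
Proof.
have q1 : q x (x.1.+1, x.2) = lam x.2 by rewrite /system_rate eqxx.
have q2 : (0 < x.1)%N -> q x (x.1.-1, x.2.+1) = mu1.
  move=> h; rewrite /system_rate h eqxx /= ifF//.
  by apply/negbTE; rewrite xpair_eqE; lia.
have q3 : (0 < x.2)%N -> q x (x.1, x.2.-1) = mu2.
  move=> h; rewrite /system_rate h eqxx /= ifF; last by apply/negbTE; rewrite xpair_eqE; lia.
  by rewrite ifF//; apply/negbTE; rewrite !xpair_eqE; lia.
rewrite /targets big_cons big_cat q1 -addrA /=; congr (_ + (_ + _)).
  by case: ifP => h; rewrite ?big_nil ?mul0r// big_seq1 q2// mul1r.
by case: ifP => h; rewrite ?big_nil ?mul0r// big_seq1 q3// mul1r.
Qed.

Lemma system_rate_ge0 x y : 0 <= q x y.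
Proof.
rewrite /system_rate; case: ifP => _ //; case: ifP => _; first exact: ltW.
by case: ifP => _ //; exact: ltW.
Qed.

Lemma exit_rateE (x : state) : exit_rate q x = total_rate x.
Proof.
rewrite /exit_rate (_ : (\esum_(y in [set y | y != x]) (q x y)%:E)%E =
    (\esum_(y in [set` targets x]) (q x y)%:E)%E).
  have fin : finite_set [set` targets x] by exact: finite_seq.
  rewrite (esum_fset fin); last by move=> y _; rewrite lee_fin system_rate_ge0.
  rewrite -fsbig_seq ?targets_uniq// sumEFin /=.
  transitivity (\sum_(y <- targets x) q x y * (fun=> 1) y).
    by apply: eq_bigr => y _; rewrite mulr1.
  by rewrite sum_targets /total_rate !mulr1.
rewrite esum_mkcond [RHS]esum_mkcond; apply: eq_esum => y _.
have [yt|yt] := boolP (y \in targets x).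
  by rewrite !mem_set//=; exact: targets_neq.
rewrite system_rate_targets// [in RHS]memNset//=; last by exact/negP.
by case: ifP.
Qed.

Definition min_rate : R := Num.min (lam 0) (Num.min mu1 mu2).
Definition max_rate : R := 1 + mu1 + mu2.

Lemma min_rate_gt0 : 0 < min_rate.
Proof. by rewrite /min_rate !lt_min lam0_gt0 mu1_gt0 mu2_gt0. Qed.

Lemma min_rate_le x : min_rate <= exit_rate q x.
Proof.
rewrite exit_rateE /total_rate /min_rate !ge_min.
case: x => -[|a] [|b] /=; rewrite ?mulr1n ?mulr0n ?mul0r ?mul1r ?addr0 ?lexx//.
- by apply/or3P; constructor 3; have := lam_ge0 b.+1; lra.
- by apply/or3P; constructor 2; have := lam_ge0 0; lra.
- by apply/or3P; constructor 2; have := lam_ge0 b.+1; have := mu2_gt0; lra.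
Qed.

Lemma le_max_rate x : exit_rate q x <= max_rate.
Proof.
rewrite exit_rateE /total_rate /max_rate.
have := lam_le1 x.2; have := mu1_gt0; have := mu2_gt0; case: (0 < x.1)%N; case: (0 < x.2)%N;
by rewrite ?mulr1n ?mulr0n; lra.
Qed.

Lemma total_rate_gt0 x : 0 < total_rate x.
Proof. by rewrite -exit_rateE (lt_le_trans min_rate_gt0) ?min_rate_le. Qed.

Lemma jump_probE x y : x != y -> P x y = q x y / total_rate x.
Proof.
by move=> xy; rewrite /jump_prob exit_rateE gt_eqF ?total_rate_gt0// (negbTE xy).
Qed.

Lemma jump_prob_ge0 x y : 0 <= P x y.
Proof.
rewrite /jump_prob exit_rateE gt_eqF ?total_rate_gt0//; case: eqP => // _.
by rewrite divr_ge0 ?system_rate_ge0// ltW// total_rate_gt0.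
Qed.

Lemma jump_prob_targets x y : y \notin targets x -> P x y = 0.
Proof.
move=> yt; rewrite /jump_prob exit_rateE gt_eqF ?total_rate_gt0//; case: eqP => // _.
by rewrite system_rate_targets// mul0r.
Qed.

(** The rate matrix applied to f. *)
Definition generator (f : state -> R) (x : state) : R :=
  lam x.2 * (f (x.1.+1, x.2) - f x) +
  (0 < x.1)%:R * mu1 * (f (x.1.-1, x.2.+1) - f x) +
  (0 < x.2)%:R * mu2 * (f (x.1, x.2.-1) - f x).

(** Off the diagonal the jump probabilities are the rates divided by the total rate. *)
Lemma step_generator f x : step P targets f x = f x + generator f x / total_rate x.
Proof.
have t0 := total_rate_gt0 x.
have -> : step P targets f x = (\sum_(y <- targets x) q x y * f y) / total_rate x.
  rewrite /step big_distrl big_seq [RHS]big_seq /=; apply: eq_bigr => y yt.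
  rewrite jump_probE; first by rewrite mulrAC.
  by rewrite eq_sym targets_neq.
rewrite sum_targets /generator; apply: (mulIf (lt0r_neq0 t0)).
by rewrite [RHS]mulrDl !divfK ?lt0r_neq0// /total_rate; ring.
Qed.

Lemma jump_prob_sum1 x : \sum_(y <- targets x) P x y = 1.
Proof.
transitivity (step P targets (fun=> 1) x).
  by apply: eq_bigr => y _; rewrite mulr1.
by rewrite step_generator /generator subrr !mulr0 !addr0 mul0r addr0.
Qed.

Local Notation reach := (reachable P targets).

Lemma reachable_trans x y z : reach x y -> reach y z -> reach x z.
Proof.
move=> [p [pp lp]] [s [ps ls]]; exists (p ++ s).
by rewrite cat_path pp lp ps last_cat lp ls.
Qed.

Lemma reachable_edge x y : 0 < q x y -> reach x y.
Proof.
move=> qxy; exists [:: y]; split=> //=.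
have yt : y \in targets x.
  by apply/negP => /negP yt; move: qxy; rewrite system_rate_targets// ltxx.
by rewrite yt andbT jump_probE 1?eq_sym ?targets_neq// divr_gt0// total_rate_gt0.
Qed.

Lemma reachable_move a b k : reach ((a + k)%N, b) (a, (b + k)%N).
Proof.
elim: k b => [|k IH] b; first by exists [::]; rewrite !addn0.
apply: (@reachable_trans _ ((a + k)%N, b.+1)); last by rewrite addnS -addSn; exact: IH.
apply: reachable_edge; rewrite /system_rate ifF; last first.
  by apply/negbTE; rewrite xpair_eqE /=; lia.
by rewrite addnS /= eqxx.
Qed.

Lemma reachable_serve a b : reach (a, b) (a, 0%N).
Proof.
elim: b => [|b IH]; first by exists [::].
apply: (@reachable_trans _ (a, b)) => //; apply: reachable_edge.
rewrite /system_rate ifF; last by apply/negbTE; rewrite xpair_eqE /=; lia.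
by rewrite ifF /= ?eqxx//; apply/negbTE; rewrite !xpair_eqE /=; lia.
Qed.

Lemma reachable_arrive a : reach (0%N, 0%N) (a, 0%N).
Proof.
elim: a => [|a IH]; first by exists [::].
apply: (reachable_trans IH); apply: reachable_edge.
by rewrite /system_rate eqxx.
Qed.

(** Empty the second queue, transfer all customers and serve them: this leads to the
empty state even if no arrival is possible on the way. From there, let c + d customers
arrive while the second queue is empty, when arrivals are open, and transfer d of
them. *)
Lemma tandem_reachable (x y : state) : reach x y.
Proof.
case: x y => [a b] [c d].
apply: (@reachable_trans _ (a, 0%N)); first exact: reachable_serve.
apply: (@reachable_trans _ (0%N, a)); first exact: (reachable_move 0 0 a).
apply: (@reachable_trans _ (0%N, 0%N)); first exact: reachable_serve.
apply: (@reachable_trans _ ((c + d)%N, 0%N)); first exact: reachable_arrive.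
exact: (reachable_move c 0 d).
Qed.

(** * Lyapunov functions inside the region *)

(** The total rate is at most [max_rate], so that a drift - eps of the process gives a
drift - eps / max_rate of its jump chain. *)
Lemma drift_integrable_return (f : state -> R) (B eps : R) : 0 < eps ->
  (forall x, B <= f x) ->
  (forall x, x != (0%N, 0%N) -> generator f x <= - eps) ->
  integrable_return P targets (0%N, 0%N).
Proof.
move=> e0 fB drift.
have m0 : 0 < max_rate by have := mu1_gt0; have := mu2_gt0; rewrite /max_rate; lra.
apply: (@foster _ _ P targets jump_prob_ge0 (0%N, 0%N) (fun x => f x - B) (eps / max_rate)).
- by rewrite divr_gt0.
- by move=> x; rewrite subr_ge0.
move=> x /drift dx; rewrite stepB step_cst; last exact: jump_prob_sum1.
rewrite step_generator addrAC lerD2l.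
have t0 := total_rate_gt0 x; rewrite ler_pdivrMr// mulNr.
apply: (le_trans dx); rewrite lerN2 mulrAC ler_pdivrMr// ler_pM2l//.
by rewrite -exit_rateE; exact: le_max_rate.
Qed.

(** The function - b ^ (L - n) on the states (0, n), n <= L, and 0 elsewhere: a departure
from (0, n) multiplies its absolute value by b, which for b = 1 + 2 / mu2 outweighs
an arrival, whose rate is at most 1. Jumps from outside its support can only lower
it. *)
Lemma boundary_penalty (L : nat) : exists h : state -> R, exists H : R,
  [/\ forall x, - H <= h x,
      forall x, ~~ ((x.1 == 0%N) && (0 < x.2 <= L)%N) -> x != (0%N, 0%N) -> generator h x <= 0 &
      forall n, (0 < n <= L)%N -> generator h (0%N, n) <= -1].
Proof.
pose b : R := 1 + 2 / mu2.
have m2 := mu2_gt0.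
have b1 : 1 <= b by rewrite lerDl divr_ge0// ltW.
have mb : mu2 * b = mu2 + 2 by rewrite mulrDr mulr1 mulrCA divff ?mulr1// gt_eqF.
pose h (x : state) : R := if (x.1 == 0%N) && (x.2 <= L)%N then - b ^+ (L - x.2) else 0.
have pw k : 1 <= b ^+ k by exact: exprn_ege1.
exists h, (b ^+ L); split.
- move=> x; rewrite /h; case: ifP => _; first by rewrite lerN2 ler_weXn2l// leq_subr.
  by rewrite oppr_le0 (le_trans ler01).
- move=> [a n] /= out ne; rewrite /generator /h /=.
  case: a out ne => [|a] out ne /=.
    have Ln : (L < n)%N by move: out ne; rewrite xpair_eqE /=; lia.
    have [-> ->] : (n <= L)%N = false /\ (0 < n)%N = true by split; lia.
    rewrite !subr0 mulr0 !mul0r !add0r mul1r.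
    by case: ifP => _; rewrite ?mulr0// mulrN oppr_le0 mulr_ge0 ?(ltW m2)// (le_trans ler01).
  rewrite !subr0 !mulr0 addr0 mul1r add0r.
  by case: ifP => _; rewrite ?mulr0// mulrN oppr_le0 mulr_ge0 ?(ltW mu1_gt0)// (le_trans ler01).
- move=> [//|n] /andP[_ nL]; rewrite /generator /h /= nL (ltnW nL) !mul0r addr0 mul1r.
  rewrite sub0r !opprK (_ : (L - n = (L - n.+1).+1)%N); last by lia.
  rewrite exprS; set p := b ^+ _; have p1 : 1 <= p by exact: pw.
  have -> : mu2 * (- (b * p) + p) = - 2 * p.
    by rewrite -[X in - (b * p) + X]mul1r -mulNr -mulrDl mulrA mulrDr mulrN mb; ring.
  have := ler_wpM2r (le_trans ler01 p1) (lam_le1 n.+1); lra.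
Qed.

(** The function x1 + g(x2) has drift at most - eps wherever x1 > 0, by the first two
conditions, and at (0, n) for n > L, by the last one. On the finitely many states left
its drift is bounded and is corrected by a multiple of [boundary_penalty]. *)
Lemma profile_integrable_return (g : nat -> R) (eps : R) (L : nat) : 0 < eps ->
  lam 0 - mu1 + mu1 * (g 1%N - g 0%N) <= - eps ->
  (forall n, lam n.+1 - mu1 + mu1 * (g n.+2 - g n.+1) + mu2 * (g n - g n.+1) <= - eps) ->
  (forall n, (L <= n)%N -> lam n.+1 + mu2 * (g n - g n.+1) <= - eps) ->
  integrable_return P targets (0%N, 0%N).
Proof.
move=> e0 g0 gS gL.
have [h [H [hH h0 h1]]] := boundary_penalty L.
(* Dominates the drift plus eps on the boundary states that need a correction. *)
pose C : R := \sum_(n < L) `|lam n.+1 + mu2 * (g n - g n.+1) + eps|.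
have C0 : 0 <= C by apply: sumr_ge0.
(* Beyond L the function g increases, so it is bounded below by its first values. *)
pose G : R := \sum_(n < L.+1) `|g n|.
have gG n : - G <= g n.
  have small k : (k <= L)%N -> - G <= g k.
    move=> kL; apply: (@le_trans _ _ (- `|g k|)); last by rewrite lerNl -normrN ler_norm.
    rewrite lerN2 /G (bigD1 (Ordinal (kL : k < L.+1)%N))//= lerDl.
    exact: sumr_ge0.
  have [nL|/ltnW nL] := leqP n L; first exact: small.
  rewrite -(subnK nL); elim: (n - L)%N => [|k IH]; first by rewrite add0n; exact: small.
  apply: (le_trans IH); have := gL (k + L)%N (leq_addl _ _); have := lam_ge0 (k + L).+1.
  rewrite addSn => l0 hh; suff : 0 <= mu2 * (g (k + L).+1 - g (k + L)%N).
    by rewrite pmulr_rge0// subr_ge0.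
  lra.
pose V (x : state) : R := x.1%:R + g x.2 + C * h x.
apply: (@drift_integrable_return V (- G - C * H) eps e0).
  move=> x; rewrite /V -[leLHS]add0r -addrA lerD//; apply: lerD; first exact: gG.
  by rewrite -mulrN ler_wpM2l.
have genV x : generator V x =
    lam x.2 + (0 < x.1)%:R * mu1 * (g x.2.+1 - g x.2 - 1) +
    (0 < x.2)%:R * mu2 * (g x.2.-1 - g x.2) + C * generator h x.
  rewrite /generator /V /=; case: x => -[|a] n /=.
    by rewrite -natr1; ring.
  by rewrite -!natr1; ring.
move=> [a n] ne; rewrite genV /=.
have [/andP[/eqP a0 /andP[n0 nL]]|out] := boolP ((a == 0%N) && (0 < n <= L)%N).
  case: n n0 nL ne => // n _ nL ne; rewrite a0 /= !mul0r addr0 mul1r.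
  have := ler_wpM2l C0 (h1 n.+1 nL); rewrite mulrN mulr1.
  have : lam n.+1 + mu2 * (g n - g n.+1) + eps <= C.
    apply: le_trans (ler_norm _) _; rewrite /C (bigD1 (Ordinal nL))//= lerDl.
    exact: sumr_ge0.
  by lra.
have := ler_wpM2l C0 (h0 (a, n) out ne); rewrite mulr0.
case: a out ne => [|a] out ne /=.
  case: n out ne => [//|n] out ne; rewrite !mul0r addr0 mul1r /=.
  have Ln : (L <= n)%N by move: out; rewrite /=; lia.
  by have := gL n Ln; lra.
rewrite mul1r; case: n out ne => [|n] out ne /=.
  by rewrite !mul0r; have := g0; lra.
by rewrite mul1r; have := gS n; lra.
Qed.

(** The increments g(n+1) - g(n) for which x1 + g(x2) has drift exactly - eps wherever
x1 > 0. *)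
Fixpoint slope (eps : R) (n : nat) : R :=
  if n is n'.+1 then (mu2 * slope eps n' + mu1 - eps - lam n) / mu1
  else (mu1 - eps - lam 0) / mu1.

Lemma slope_perturb n : exists2 C : R, 0 <= C &
  forall eps, 0 <= eps -> slope 0 n - C * eps <= slope eps n.
Proof.
have m1 := mu1_gt0; have m2 := mu2_gt0.
elim: n => [|n [C C0 IH]] /=.
  exists mu1^-1 => [|eps e0]; first by rewrite invr_ge0 ltW.
  by rewrite (mulrC _ eps) -mulrBl ler_pM2r ?invr_gt0//; lra.
exists ((mu2 * C + 1) / mu1) => [|eps e0].
  by rewrite divr_ge0 ?(ltW m1)// addr_ge0// mulr_ge0// ltW.
rewrite mulrAC -mulrBl ler_pM2r ?invr_gt0//.
by have := ler_wpM2l (ltW m2) (IH eps e0); lra.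
Qed.

(** The increments follow [slope eps] up to L and are then constant, equal to
eta = (l + eps) / mu2. This value is large enough for departures to beat arrivals of
rate l at x1 = 0; it is at most 1, so that x1 + eta x2 has negative drift for x1 > 0
beyond L; and it has to be at most slope eps L for the transition at L, which holds
for small eps as slope 0 L exceeds l / mu2. *)
Lemma slope_integrable_return (l : R) (L : nat) : 0 <= l -> l < mu2 ->
  (forall n, (L <= n)%N -> lam n.+1 = l) -> l / mu2 < slope 0 L ->
  integrable_return P targets (0%N, 0%N).
Proof.
move=> l0 lmu2 lamL lslope.
have m1 := mu1_gt0; have m2 := mu2_gt0.
have [C C0 hC] := slope_perturb L.
pose s := slope 0 L - l / mu2; have s0 : 0 < s by rewrite subr_gt0.
have c1 : 0 < C + mu2^-1 by rewrite ltr_wpDl// invr_gt0.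
(* The first bound makes eta at most 1, the second one keeps eta below slope eps L. *)
pose eps := Num.min (mu2 - l) (s / (C + mu2^-1)).
have e0 : 0 < eps by rewrite lt_min subr_gt0 lmu2 divr_gt0.
have e1 : l + eps <= mu2.
  by rewrite -lerBrDl /eps ge_min lexx.
pose eta := (l + eps) / mu2.
have eta_mu2 : mu2 * eta = l + eps by rewrite mulrC divfK// gt_eqF.
have eta_le1 : eta <= 1 by rewrite ler_pdivrMr// mul1r.
have eta_slope : eta <= slope eps L.
  apply: le_trans (hC eps (ltW e0)).
  have : eps * (C + mu2^-1) <= s by rewrite -ler_pdivlMr// /eps ge_min lexx orbT.
  by rewrite /s /eta mulrDl; lra.
pose d n := if (n < L)%N then slope eps n else eta.
pose g n := \sum_(k < n) d k.
have gS n : g n.+1 - g n = d n by rewrite /g big_ord_recr /= addrAC subrr add0r.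
have slope0 : mu1 * slope eps 0 = mu1 - eps - lam 0 by rewrite /= mulrC divfK// gt_eqF.
have slopeS n : mu1 * slope eps n.+1 = mu2 * slope eps n + mu1 - eps - lam n.+1.
  by rewrite /= mulrC divfK// gt_eqF.
have m1e : mu1 * eta <= mu1 by rewrite ler_piMr// ltW.
have m1s : mu1 * eta <= mu1 * slope eps L by rewrite ler_pM2l.
apply: (@profile_integrable_return g eps L e0).
- rewrite gS /d; case: ltnP => [_|]; first by rewrite slope0; lra.
  by rewrite leqn0 => /eqP L0; move: m1s; rewrite L0 slope0; lra.
- move=> n; rewrite gS -(opprB (g n.+1) (g n)) gS /d; case: (ltnP n.+1 L) => nL.
    by rewrite (ltnW nL) slopeS; lra.
  case: (ltnP n L) => nL'.
    have LE : L = n.+1 by apply/eqP; rewrite eqn_leq nL nL'.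
    by move: m1s; rewrite LE slopeS; lra.
  by rewrite lamL//; lra.
- by move=> n Ln; rewrite -(opprB (g n.+1) (g n)) gS /d ltnNge Ln /= lamL//; lra.
Qed.

(** The recursion becomes a telescoping sum after multiplication by (mu1 / mu2) ^ n. *)
Lemma slope_closed_form n :
  mu1 * (mu1 / mu2) ^+ n * slope 0 n = \sum_(k < n.+1) (mu1 - lam k) * (mu1 / mu2) ^+ k.
Proof.
have m1 := mu1_gt0; have m2 := mu2_gt0.
elim: n => [|n IH].
  by rewrite big_ord_recl big_ord0 addr0 /= expr0 !mulr1 subr0 mulrC divfK// gt_eqF.
rewrite big_ord_recr /= -IH exprSr subr0.
set r := _ ^+ n; set s := slope 0 n; field.
by rewrite !gt_eqF.
Qed.

(** With r = mu1 / mu2 and S n = 1 + ... + r ^ (n-1), the closed form has the sign of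
mu1 S (L+1) - S (k+1) for L >= k. For large L this is positive: if r >= 1 since S is
unbounded, and if r < 1 since it tends to (mu1 - (1 - r ^ (k+1))) / (1 - r), which the
inequality of the region makes positive. *)
Lemma threshold_return (k : nat) : (forall n, lam n = if (n <= k)%N then 1 else 0) ->
  1 - (mu1 / mu2) ^+ k.+1 < Num.min mu1 mu2 ->
  integrable_return P targets (0%N, 0%N).
Proof.
move=> lamE reg; have m1 := mu1_gt0; have m2 := mu2_gt0.
pose r := mu1 / mu2; have r0 : 0 < r by rewrite divr_gt0.
pose S n : R := \sum_(i < n) r ^+ i.
have [L kL SL] : exists2 L, (k <= L)%N & S k.+1 < mu1 * S L.+1.
  have [r1|r1] := ltP r 1.
    have Sr n : (1 - r) * S n = 1 - r ^+ n.
      by have := subrX1 r n; rewrite -/(S n); lra.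
    have mr : 1 - r ^+ k.+1 < mu1.
      by move: reg; rewrite lt_min => /andP[].
    have /cvgrPdist_lt : (fun n => r ^+ n) @ \oo --> 0.
      by apply: cvg_expr; rewrite ger0_norm// ltW.
    pose e := (mu1 - (1 - r ^+ k.+1)) / mu1.
    have e0 : 0 < e by rewrite divr_gt0// subr_gt0.
    move=> /(_ e e0)[N _ hN]; exists (maxn k N); first exact: leq_maxl.
    have r1' : 0 < 1 - r by rewrite subr_gt0.
    rewrite -(ltr_pM2l r1') mulrCA !Sr.
    have := hN (maxn k N).+1 (leqW (leq_maxr _ _)).
    rewrite /= sub0r normrN ger0_norm ?exprn_ge0 ?(ltW r0)//.
    have me : mu1 * e = mu1 - (1 - r ^+ k.+1) by rewrite mulrC divfK// gt_eqF.
    move=> he; have : mu1 * r ^+ (maxn k N).+1 < mu1 * e by rewrite ltr_pM2l.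
    by rewrite me; lra.
  have Sn n : n%:R <= S n.
    rewrite -[n in n%:R]card_ord -sumr_const; apply: ler_sum => i _.
    exact: exprn_ege1.
  pose N := Num.truncn (S k.+1 / mu1); exists (maxn k N); first exact: leq_maxl.
  rewrite mulrC -ltr_pdivrMr//; apply: lt_le_trans (truncnS_gt _) _.
  by apply: le_trans (Sn _); rewrite ler_nat ltnS leq_maxr.
apply: (@slope_integrable_return 0 L) => //.
  by move=> n Ln; rewrite lamE ifF//; apply/negbTE; rewrite -ltnNge ltnS (leq_trans kL).
rewrite mul0r -(pmulr_rgt0 _ (_ : 0 < mu1 * r ^+ L)); last by rewrite mulr_gt0// exprn_gt0.
rewrite slope_closed_form -/r.
have -> : \sum_(i < L.+1) (mu1 - lam i) * r ^+ i = mu1 * S L.+1 - \sum_(i < L.+1) lam i * r ^+ i.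
  by rewrite /S big_distrr -sumrB; apply: eq_bigr => i _; rewrite mulrBl.
rewrite subr_gt0 (_ : \sum_(i < L.+1) _ = S k.+1)//.
have kL' : (k.+1 <= L.+1)%N by [].
rewrite /S (big_ord_widen _ (fun i => r ^+ i) kL') [RHS]big_mkcond /=.
by apply: eq_bigr => i _; rewrite lamE ltnS; case: ifP; rewrite ?mul1r ?mul0r.
Qed.

(** As long as the increments stay below 1 / mu2 they grow by a fixed positive amount at
each step, so they eventually exceed this value. *)
Lemma full_input_return : (forall n, lam n = 1) -> 1 < Num.min mu1 mu2 ->
  integrable_return P targets (0%N, 0%N).
Proof.
move=> lam1; rewrite lt_min => /andP[mu1_gt1 mu2_gt1].
have m1 := mu1_gt0; have m2 := mu2_gt0.
suff [L hL] : exists L, 1 / mu2 < slope 0 L.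
  by apply: (@slope_integrable_return 1 L).
apply: contrapT => no; have small n : slope 0 n <= 1 / mu2.
  by rewrite leNgt; apply/negP => h; apply: no; exists n.
(* The two entries bound the growth from below for mu1 <= mu2 and for mu1 > mu2. *)
pose del := Num.min ((mu1 - 1) / mu1) (1 - mu2^-1).
have inv1 : mu2^-1 < 1 by rewrite invf_lt1.
have del0 : 0 < del by rewrite lt_min divr_gt0 ?subr_gt0.
have grow n : n.+1%:R * del <= slope 0 n.
  elim: n => [|n IH] /=.
    by rewrite mul1r subr0 lam1 /del ge_min lexx.
  have s0 : 0 <= slope 0 n by rewrite (le_trans _ IH)// mulr_ge0// ltW.
  rewrite -[n.+2%:R]natr1 mulrDl mul1r; apply: (le_trans (lerD IH (lexx del))).
  rewrite ler_pdivlMr// subr0 lam1; have sn := small n; set s := slope 0 n in s0 sn *.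
  have d1 : del * mu1 <= mu1 - 1 by rewrite -ler_pdivlMr// /del ge_min lexx.
  have d2 : del <= 1 - mu2^-1 by rewrite /del ge_min lexx orbT.
  have [m12|m12] := leP mu1 mu2; first by have := ler_wpM2r s0 m12; lra.
  have := ler_wpM2l (ltW m1) d2; rewrite mulrBr mulr1 => d3.
  have : s * (mu1 - mu2) <= (1 / mu2) * (mu1 - mu2) by rewrite ler_wpM2r// subr_ge0 ltW.
  by rewrite mul1r [in leRHS]mulrBr mulVf ?gt_eqF//; lra.
pose N := Num.truncn (1 / mu2 / del).
have := le_trans (grow N) (small N); rewrite leNgt; apply/negP; rewrite negbK.
by rewrite -ltr_pdivrMr// truncnS_gt.
Qed.

(** * Balance equations force the region *)

Section Balance.
Hypothesis rec : integrable_return P targets (0%N, 0%N).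

(** Dividing by the total rate turns the occupation measure of the jump chain into the
expected time spent during an excursion, an invariant measure of the process. *)
Definition time_mean (f : state -> R) : R :=
  occ P targets (0%N, 0%N) (fun x => f x / total_rate x).

Definition mass (b : state -> bool) : R := time_mean (fun x => (b x)%:R).

Lemma sup_bounded_rate f : sup_bounded f -> sup_bounded (fun x => f x / total_rate x).
Proof.
move=> bf; apply: sup_boundedM => //; exists min_rate^-1 => x.
rewrite ger0_norm ?invr_ge0 ?(ltW (total_rate_gt0 x))//.
rewrite lef_pV2 ?posrE ?total_rate_gt0 ?min_rate_gt0//.
by rewrite -exit_rateE min_rate_le.
Qed.

Lemma sup_bounded_mul_bool (c : R) (b : state -> bool) : sup_bounded (fun x => c * (b x)%:R).
Proof. by apply: sup_boundedM; [exact: sup_bounded_cst|exact: sup_bounded_bool]. Qed.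

Lemma time_meanB f g : sup_bounded f -> sup_bounded g ->
  time_mean (fun x => f x - g x) = time_mean f - time_mean g.
Proof.
move=> bf bg; rewrite /time_mean -(occB jump_prob_ge0 rec); try exact: sup_bounded_rate.
by congr occ; apply/funext => x; rewrite mulrBl.
Qed.

Lemma time_meanD f g : sup_bounded f -> sup_bounded g ->
  time_mean (fun x => f x + g x) = time_mean f + time_mean g.
Proof.
move=> bf bg; rewrite /time_mean -(occD jump_prob_ge0 rec); try exact: sup_bounded_rate.
by congr occ; apply/funext => x; rewrite mulrDl.
Qed.

Lemma time_meanZ c f : sup_bounded f -> time_mean (fun x => c * f x) = c * time_mean f.
Proof.
move=> bf; rewrite /time_mean -(occZ jump_prob_ge0 rec); last exact: sup_bounded_rate.
by congr occ; apply/funext => x; rewrite mulrA.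
Qed.

Lemma le_time_mean f g : sup_bounded f -> sup_bounded g -> (forall x, f x <= g x) ->
  time_mean f <= time_mean g.
Proof.
move=> bf bg fg; apply: (le_occ jump_prob_ge0 rec); try exact: sup_bounded_rate.
by move=> x; rewrite ler_pM2r ?invr_gt0 ?total_rate_gt0.
Qed.

Lemma le_mass (b c : pred state) : (forall x, b x -> c x) -> mass b <= mass c.
Proof.
move=> bc; apply: le_time_mean; try exact: sup_bounded_bool.
by move=> x; case: (boolP (b x)) => [/bc ->|].
Qed.

Lemma mass_origin_gt0 : 0 < mass (pred1 (0%N, 0%N)).
Proof.
have o1 := occ_start P targets (0%N, 0%N).
rewrite /mass /time_mean (_ : (fun x => _) =
  (fun x => (total_rate (0%N, 0%N))^-1 * (x == (0%N, 0%N))%:R)); last first.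
  by apply/funext => x /=; case: eqP => [->|]; rewrite ?mul1r ?mulr1 ?mul0r ?mulr0.
rewrite (occZ jump_prob_ge0 rec); last exact: sup_bounded_bool.
by rewrite o1 mulr1 invr_gt0 total_rate_gt0.
Qed.

(** Rate conservation: the jump chain leaves [occ] invariant, and the increment of f in
one step is generator f / total_rate. *)
Lemma time_mean_generator f : sup_bounded f -> sup_bounded (generator f) ->
  time_mean (generator f) = 0.
Proof.
move=> bf bg; rewrite /time_mean.
have sE : step P targets f = fun x => f x + generator f x / total_rate x.
  by apply/funext => x; exact: step_generator.
have := occ_step jump_prob_ge0 jump_prob_sum1 rec bf.
rewrite sE (occD jump_prob_ge0 rec) //; last exact: sup_bounded_rate.
by lra.
Qed.

(** The total number of customers grows by at most 1 at each jump. *)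
Lemma mass_tail e : 0 < e -> exists n, mass (fun x => (n <= x.1 + x.2)%N) <= e.
Proof.
move=> e0; have m0 := min_rate_gt0.
have [|||n hn] := @occ_rank_tail _ _ P targets jump_prob_ge0
    (0%N, 0%N) rec (fun x => x.1 + x.2)%N (e * min_rate).
- by [].
- move=> [a b] [c d]; rewrite /targets inE mem_cat /=.
  by case: a => [|a]; case: b => [|b]; rewrite /= ?inE !xpair_eqE /=; lia.
- by rewrite mulr_gt0.
exists n; rewrite -(ler_pM2r m0); apply: le_trans hn.
rewrite mulrC /mass -time_meanZ; last exact: sup_bounded_bool.
apply: (le_occ jump_prob_ge0 rec).
- by apply: sup_bounded_rate; exact: sup_bounded_mul_bool.
- exact: sup_bounded_bool.
move=> x; rewrite ler_pdivrMr ?total_rate_gt0// mulrC ler_wpM2l//.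
by rewrite -exit_rateE min_rate_le.
Qed.

(** Rate conservation for a bounded integer-valued F that jumps up with total rate u and
down with rate c on dn. *)
Lemma cut_balance (F : state -> nat) (u : state -> R) (c : R) (dn : pred state)
    (C : nat) : sup_bounded u -> (forall x, (F x <= C)%N) ->
  (forall x, generator (fun y => (F y)%:R) x = u x - c * (dn x)%:R) ->
  time_mean u = c * mass dn.
Proof.
move=> bu FC gE; apply/eqP; rewrite -subr_eq0; apply/eqP.
have bF : sup_bounded (fun y => (F y)%:R : R).
  by exists C%:R => y; rewrite ger0_norm// ler_nat.
have gE' : generator (fun y => (F y)%:R) = fun x => u x - c * (dn x)%:R.
  exact/funext.
have bg : sup_bounded (generator (fun y => (F y)%:R)).
  by rewrite gE'; apply: sup_boundedB => //; exact: sup_bounded_mul_bool.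
have := time_mean_generator bF bg.
rewrite gE' time_meanB//; last exact: sup_bounded_mul_bool.
by rewrite time_meanZ; last exact: sup_bounded_bool.
Qed.

Lemma minn_succ (a n : nat) : (minn a.+1 n)%:R = (minn a n)%:R + (a < n)%:R :> R.
Proof. by rewrite -natrD; congr (_%:R); case: ltnP; lia. Qed.

Lemma minn_succB (a n : nat) : (minn a.+1 n)%:R - (minn a n)%:R = (a < n)%N%:R :> R.
Proof. by rewrite minn_succ addrAC subrr add0r. Qed.

(** For F = min (x2 - n, m), transfers with n <= x2 < n + m balance departures with
n < x2 <= n + m; then m tends to infinity. *)
Lemma mass_level n : mu2 * mass (fun x => (n < x.2)%N) <= mu1 * mass (fun x => (n <= x.2)%N).
Proof.
have m1 := mu1_gt0; have m2 := mu2_gt0.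
apply/ler_addgt0Pr => e e0.
have [m hm] := mass_tail (divr_gt0 e0 m2).
have cut : mu1 * mass (fun x => [&& 0 < x.1, n <= x.2 & x.2 < n + m]%N) =
    mu2 * mass (fun x => (n < x.2 <= n + m)%N).
  rewrite -time_meanZ; last exact: sup_bounded_bool.
  apply: (@cut_balance (fun x => minn (x.2 - n) m) _ _ _ m).
  - exact: sup_bounded_mul_bool.
  - by move=> x; exact: geq_minr.
  move=> [a b]; rewrite /generator /= subrr mulr0 add0r; congr (_ + _).
    case: a => [|a]; first by rewrite !mul0r mulr0.
    rewrite mul1r; congr (_ * _); case: (leqP n b) => nb /=.
      by rewrite subSn// minn_succ addrAC subrr add0r ltn_subLR.
    by rewrite (_ : b.+1 - n = b - n)%N ?subrr//; lia.
  case: b => [|b]; first by rewrite ltn0 !mul0r mulr0 oppr0.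
  rewrite mul1r -mulrN; congr (_ * _); rewrite ltnS; case: (leqP n b) => nb /=.
    by rewrite subSn// minn_succ opprD addrA subrr add0r ltn_subLR.
  by rewrite (_ : b.+1 - n = b - n)%N ?subrr ?oppr0//; lia.
have split_mass : mass (fun x => (n < x.2)%N) <=
    mass (fun x => (n < x.2 <= n + m)%N) + mass (fun x => (m <= x.1 + x.2)%N).
  rewrite -time_meanD; try exact: sup_bounded_bool.
  apply: le_time_mean; first exact: sup_bounded_bool.
    by apply: sup_boundedD; exact: sup_bounded_bool.
  move=> [a b] /=; rewrite -natrD ler_nat.
  by case: (ltnP n b); case: (leqP b (n + m)); case: (leqP m (a + b)); lia.
have le1 : mass (fun x => [&& 0 < x.1, n <= x.2 & x.2 < n + m]%N) <=
    mass (fun x => (n <= x.2)%N) by apply: le_mass => x /and3P[].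
have := ler_wpM2l (ltW m1) le1; rewrite cut => le1'.
have := ler_wpM2l (ltW m2) (le_trans split_mass (lerD (lexx _) hm)).
by rewrite mulrDr [mu2 * (e / _)]mulrC divfK ?gt_eqF//; lra.
Qed.

Lemma mass_level_geometric n :
  mass (fun x => (n <= x.2)%N) <= (mu1 / mu2) ^+ n * mass predT.
Proof.
have m1 := mu1_gt0; have m2 := mu2_gt0.
elim: n => [|n IH]; first by rewrite mul1r; exact: le_mass.
have := mass_level n; rewrite -ler_pdivlMl// => /le_trans; apply.
rewrite (_ : _ ^+ n.+1 * mass predT = mu2^-1 * (mu1 * ((mu1 / mu2) ^+ n * mass predT))).
  by rewrite !ler_pM2l ?invr_gt0.
by rewrite exprS !mulrA (mulrC mu1).
Qed.

Lemma sup_bounded_lam : sup_bounded (fun x : state => lam x.2).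
Proof. by exists 1 => x; rewrite ger0_norm. Qed.

(** For F = min (x1, n), arrivals with x1 < n balance transfers with 0 < x1 <= n; then n
tends to infinity. *)
Lemma mean_input_le1 : time_mean (fun x => lam x.2) <= mu1 * mass (fun x => (0 < x.1)%N).
Proof.
have m1 := mu1_gt0; apply/ler_addgt0Pr => e /mass_tail[n hn].
have bu : sup_bounded (fun x : state => lam x.2 * (x.1 < n)%N%:R).
  by apply: sup_boundedM; [exact: sup_bounded_lam|exact: sup_bounded_bool].
have cut : time_mean (fun x => lam x.2 * (x.1 < n)%N%:R) =
    mu1 * mass (fun x => (0 < x.1 <= n)%N).
  apply: (@cut_balance (fun x => minn x.1 n) _ _ _ n bu); first by move=> x; exact: geq_minr.
  move=> [a b]; rewrite /generator /= subrr mulr0 addr0 minn_succ addrAC subrr add0r.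
  congr (_ + _); case: a => [|a]; first by rewrite !mul0r mulr0 oppr0.
  by rewrite mul1r /= minn_succ opprD addrA subrr add0r mulrN.
have le1 : time_mean (fun x => lam x.2) <=
    time_mean (fun x => lam x.2 * (x.1 < n)%N%:R) + mass (fun x => (n <= x.1 + x.2)%N).
  rewrite -time_meanD//; last exact: sup_bounded_bool.
  apply: le_time_mean; first exact: sup_bounded_lam.
    by apply: sup_boundedD => //; exact: sup_bounded_bool.
  move=> [a b] /=; case: (ltnP a n) => an; first by rewrite mulr1 lerDl.
  by rewrite mulr0 add0r (leq_trans an) ?leq_addr.
have : mass (fun x => (0 < x.1 <= n)%N) <= mass (fun x => (0 < x.1)%N).
  by apply: le_mass => x /andP[].
move=> /(ler_wpM2l (ltW m1)); rewrite -cut; lra.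
Qed.

(** For F = min (x1 + x2, n), transfers cancel out and arrivals below level n balance
departures. *)
Lemma mean_input_le2 : time_mean (fun x => lam x.2) <= mu2 * mass (fun x => (0 < x.2)%N).
Proof.
have m2 := mu2_gt0; apply/ler_addgt0Pr => e /mass_tail[n hn].
have bu : sup_bounded (fun x : state => lam x.2 * (x.1 + x.2 < n)%N%:R).
  by apply: sup_boundedM; [exact: sup_bounded_lam|exact: sup_bounded_bool].
have cut : time_mean (fun x => lam x.2 * (x.1 + x.2 < n)%N%:R) =
    mu2 * mass (fun x => (0 < x.2)%N && (x.1 + x.2 <= n)%N).
  apply: (@cut_balance (fun x => minn (x.1 + x.2) n) _ _ _ n bu).
    by move=> x; exact: geq_minr.
  move=> [a b]; rewrite /generator /= addSn minn_succB -addrA.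
  congr (_ + _); rewrite (_ : (0 < a)%N%:R * _ * _ = 0) ?add0r; last first.
    by case: a => [|a]; [rewrite !mul0r|rewrite /= addSnnS subrr mulr0].
  case: b => [|b]; first by rewrite !mul0r mulr0 oppr0.
  by rewrite mul1r /= addnS minn_succ opprD addrA subrr add0r mulrN.
have le1 : time_mean (fun x => lam x.2) <=
    time_mean (fun x => lam x.2 * (x.1 + x.2 < n)%N%:R) + mass (fun x => (n <= x.1 + x.2)%N).
  rewrite -time_meanD//; last exact: sup_bounded_bool.
  apply: le_time_mean; first exact: sup_bounded_lam.
    by apply: sup_boundedD => //; exact: sup_bounded_bool.
  by move=> [a b] /=; case: (ltnP (a + b) n) => an; rewrite ?mulr1 ?mulr0 ?addr0 ?add0r.
have : mass (fun x => (0 < x.2)%N && (x.1 + x.2 <= n)%N) <= mass (fun x => (0 < x.2)%N).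
  by apply: le_mass => x /andP[].
move=> /(ler_wpM2l (ltW m2)); rewrite -cut; lra.
Qed.

Lemma mass_lt (b : pred state) : ~~ b (0%N, 0%N) -> mass b < mass predT.
Proof.
move=> b0; apply: (@lt_le_trans _ _ (mass b + mass (pred1 (0%N, 0%N)))).
  by rewrite ltrDl mass_origin_gt0.
rewrite -time_meanD; try exact: sup_bounded_bool.
apply: le_time_mean; last first.
- by move=> x /=; rewrite -natrD ler_nat; case: eqP => [->|]; rewrite ?(negbTE b0)//; case: (b x).
- exact: sup_bounded_bool.
- by apply: sup_boundedD; exact: sup_bounded_bool.
Qed.

Lemma mass_all_gt0 : 0 < mass predT.
Proof. by apply: lt_le_trans mass_origin_gt0 _; exact: le_mass. Qed.

(** The input 1 is at most mu1 times the fraction of time when the first queue is busy,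
which is less than 1; similarly for mu2. *)
Lemma full_input_region : (forall n, lam n = 1) -> 1 < Num.min mu1 mu2.
Proof.
move=> lam1; have m1 := mu1_gt0; have m2 := mu2_gt0.
have inE : time_mean (fun x => lam x.2) = mass predT.
  by congr time_mean; apply/funext => x; rewrite lam1.
have t0 := mass_all_gt0.
rewrite lt_min -(ltr_pM2r t0) mul1r -[X in _ && X](ltr_pM2r t0) mul1r -inE.
rewrite (le_lt_trans mean_input_le1) ?inE ?ltr_pM2l ?mass_lt//=.
by rewrite -inE (le_lt_trans mean_input_le2) ?inE ?ltr_pM2l ?mass_lt.
Qed.

(** If mu1 >= mu2 the left-hand side is at most 0. Otherwise, input enters while x2 <= k,
a fraction of time at least 1 - (mu1 / mu2) ^ (k+1) by [mass_level_geometric], and the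
mean input is less than mu1 by [mean_input_le1] since the first queue is sometimes
empty. *)
Lemma threshold_region k : (forall n, lam n = if (n <= k)%N then 1 else 0) ->
  1 - (mu1 / mu2) ^+ k.+1 < Num.min mu1 mu2.
Proof.
move=> lamE; have m1 := mu1_gt0; have m2 := mu2_gt0.
have t0 := mass_all_gt0.
have [r1|r1] := leP 1 (mu1 / mu2).
  apply: (@le_lt_trans _ _ 0); last by rewrite lt_min m1 m2.
  by rewrite subr_le0 exprn_ege1.
have m12 : mu1 < mu2 by rewrite -[mu2]mul1r -ltr_pdivrMr.
rewrite (min_idPl (ltW m12)).
have inE : mass predT = time_mean (fun x => lam x.2) + mass (fun x => (k.+1 <= x.2)%N).
  rewrite -time_meanD; [|exact: sup_bounded_lam|exact: sup_bounded_bool].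
  congr time_mean; apply/funext => x /=; rewrite lamE.
  by case: leqP => _; rewrite ?addr0 ?add0r.
have geo := mass_level_geometric k.+1.
have lt1 : mu1 * mass (fun x => (0 < x.1)%N) < mu1 * mass predT.
  by rewrite ltr_pM2l// mass_lt.
have in1 := mean_input_le1.
rewrite -(ltr_pM2r t0) mulrBl mul1r; lra.
Qed.

End Balance.

(** * The stability region *)

(** All states communicate, so only the return to the empty state has to be controlled,
and exit rates between two positive constants make the return time of the process
and that of its jump chain integrable together. *)
Lemma stable_return :
  stable lam mu1 mu2 <-> integrable_return P targets (0%N, 0%N).
Proof.
split.
  move=> [M [_ pr]]; have [q0|fin] := pr (0%N, 0%N).
    by have := lt_le_trans min_rate_gt0 (min_rate_le (0%N, 0%N)); rewrite q0 ltxx.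
  exact: (integral_return_time_fin jump_prob_ge0 targets_uniq
    jump_prob_targets min_rate_le le_max_rate fin).
move=> ret.
have rate_gt0 x : 0 < exit_rate q x by exact: lt_le_trans min_rate_gt0 (min_rate_le x).
have [M] := minimal_process_exists jump_prob_ge0 jump_prob_sum1 targets_uniq
  jump_prob_targets rate_gt0 (0%N, 0%N).
exists M; split.
  exact: (irreducible_reachable M min_rate_gt0 min_rate_le tandem_reachable).
move=> x; right.
apply: (integrable_return_integral M jump_prob_ge0 jump_prob_sum1 targets_uniq
  jump_prob_targets min_rate_gt0 min_rate_le le_max_rate).
exact: (integrable_return_reachable jump_prob_ge0 jump_prob_sum1 ret (tandem_reachable _ _)).
Qed.

End Tandem.

Lemma stable_region (R : realType) (K : option nat) (mu1 mu2 : R) :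
  0 < mu1 -> 0 < mu2 -> stable (threshold R K) mu1 mu2 <-> region R K (mu1, mu2).
Proof.
move=> m1 m2.
have lam0 n : 0 <= threshold R K n by case: K => [k|] //=; case: ifP.
have lam1 n : threshold R K n <= 1 by case: K {lam0} => [k|] //=; case: ifP.
have lamp : 0 < threshold R K 0 by case: K {lam0 lam1} => [k|] /=.
rewrite (stable_return lam0 lam1 lamp m1 m2); case: K lam0 lam1 lamp => [k|] lam0 lam1 lamp.
  split=> [ret|[_ _ reg]].
    split=> //; exact: (threshold_region lam0 lam1 lamp m1 m2 ret).
  exact: (@threshold_return _ _ _ _ lam0 lam1 lamp m1 m2 k).
split=> [ret|[_ _ reg]].
  split=> //; exact: (full_input_region lam0 lam1 lamp m1 m2 ret).
exact: (@full_input_return _ _ _ _ lam0 lam1 lamp m1 m2).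
Qed.

(** If mu1 > mu2 the inequality holds for every threshold, otherwise the powers of
mu1 / mu2 are nonincreasing. *)
Lemma region_succ (R : realType) (k : nat) :
  region R (Some k.+1) `<=` region R (Some k).
Proof.
move=> [m1 m2] [/= m1_gt0 m2_gt0 reg]; split=> //=.
have [r1|r1] := leP (m1 / m2) 1; last first.
  apply: (@le_lt_trans _ _ 0); last by rewrite lt_min m1_gt0 m2_gt0.
  by rewrite subr_le0 exprn_ege1// ltW.
apply: le_lt_trans reg; rewrite lerD2l lerN2.
by apply: ler_wiXn2l => //; rewrite divr_ge0// ltW.
Qed.

Theorem mainTheorem5 (R : realType) :
  [/\ forall K : option nat,
        [set mu : R * R | [/\ 0 < mu.1, 0 < mu.2 &
                             stable (threshold R K) mu.1 mu.2]]
        = region R K,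
      forall k : nat, region R (Some k.+1) `<` region R (Some k) &
      \bigcup_(K in [set: option nat]) region R K = region R (Some 0%N)].
Proof.
split.
- move=> K; apply/seteqP; split => -[m1 m2].
    by move=> [/= p1 p2 st]; apply/stable_region.
  move=> reg; have [p1 p2 _] := reg; split=> //.
  exact/(stable_region K p1 p2).
- move=> k; split; first exact: region_succ.
  (* With mu2 = 2 mu1, this value of mu1 turns the condition for k+1 into an equality. *)
  pose m1 : R := 1 - 2^-1 ^+ k.+2.
  have h0 : 0 < 2^-1 ^+ k.+2 :> R by rewrite exprn_gt0// invr_gt0.
  have h1 : 2^-1 ^+ k.+2 < 2^-1 ^+ k.+1 :> R.
    by rewrite ltr_iXn2l ?invr_gt0// invf_lt1// ltr1n.
  have h2 : 2^-1 ^+ k.+1 <= 1 :> R by rewrite exprn_ile1 ?invr_ge0// invf_le1// ler1n.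
  have m1_gt0 : 0 < m1 by rewrite subr_gt0 (lt_le_trans h1).
  have r : m1 / (m1 *+ 2) = 2^-1 by rewrite -[in LHS](mulr_natr m1 2) invfM mulrA divff ?gt_eqF// mul1r.
  have mE : Num.min m1 (m1 *+ 2) = m1 by apply/min_idPl; rewrite mulr2n lerDl ltW.
  move=> /(_ (m1, m1 *+ 2)) sub.
  have [] : region R (Some k.+1) (m1, m1 *+ 2).
    apply: sub; split=> //=; first by rewrite mulr2n addr_gt0.
    by rewrite r mE /m1 ltrD2l ltrN2.
  by move=> _ _; rewrite /= r mE ltxx.
- apply/seteqP; split; last by move=> mu h; exists (Some 0%N).
  move=> [m1 m2] [[k|] _].
    by elim: k => // k IH /region_succ.
  move=> [/= p1 p2 h]; split=> //=; apply: lt_trans h.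
  by rewrite expr1 ltrBlDr ltrDl divr_gt0.
Qed.
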